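(* Suppose that $X_1,\dots,X_n$ are independent zero-mean real-valued random variables and $U_1,\dots,U_n$ are independent random variables uniformly distributed on $[0,1]$, which are also independent of $X_1,\dots,X_n$. For each $i=1,\dots,n$ let $$Y_i:=|X_i\,\mathsf{r}_i(X_i,(U_i)_{X_i})|,$$ where $\mathsf{r}_i$ is the reciprocating function of $X_i$ and $(U_i)_{X_i}$ is the randomization variable built from $X_i$ and $U_i$ (see context). For any $\lambda>0$ let $$S_{Y,\lambda}:=\frac{X_1+\dots+X_n}{(Y_1^\lambda+\dots+Y_n^\lambda)^{\frac1{2\lambda}}},$$ where the rule $\frac00:=0$ is used if the denominator is zero. Then for every nonnegative Borel function $f$ on $\mathbb{R}$ $$\mathsf{E}f(S_{Y,\lambda})\le\max\bigl(f(0),\,\sup\mathsf{E}f(Z_1+\dots+Z_n)\bigr),$$ where the supremum is taken over all $n$-tuples of independent zero-mean random variables $Z_1,\dots,Z_n$ with the property that each $Z_i$ takes on only two values, say $c_i$ and $d_i$ (each attained with positive probability; the degenerate case $c_i=d_i=0$ is allowed), such that $$|c_1d_1|^\lambda+\dots+|c_nd_n|^\lambda=1.$$ (Note that $\operatorname{Var}Z_i=|c_id_i|$ for all $i$.)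
   Context: For a zero-mean real-valued random variable $X$ define $$G(x):=\begin{cases}\mathsf{E}X\,\mathbf{I}\{X\in(0,x]\} & \text{if } x\in[0,\infty],\\ \mathsf{E}(-X)\,\mathbf{I}\{X\in[x,0)\} & \text{if } x\in[-\infty,0],\end{cases}$$ ($\mathbf{I}\{\cdot\}$ is the indicator) and $m:=G(\infty)=G(-\infty)=\frac12\mathsf{E}|X|<\infty$. For $h\in[0,m]$ let $$x_+(h):=\inf\{x\in[0,\infty]\colon G(x)\ge h\},\qquad x_-(h):=\sup\{x\in[-\infty,0]\colon G(x)\ge h\}.$$ For $x\in\mathbb{R}$ and $u\in[0,1]$ let $$H(x,u):=\begin{cases}G(x-)+u\,(G(x)-G(x-)) & \text{if } x\in[0,\infty),\\ G(x+)+u\,(G(x)-G(x+)) & \text{if } x\in(-\infty,0],\end{cases}$$ where $G(x\mp)$ are one-sided limits ($G$ is continuous at $0$ with $G(0)=0$, so the two lines agree at $x=0$). The reciprocating function of (the distribution of) $X$ is $$\mathsf{r}(x,u):=\begin{cases}x_-(H(x,u)) & \text{if } x\in[0,\infty),\\ x_+(H(x,u)) & \text{if } x\in(-\infty,0].\end{cases}$$ If $U$ is uniformly distributed on $[0,1]$ and independent of $X$, then for real $x$ put $U_x:=U$ if $\mathsf{P}(X=x)\neq0$ and $U_x:=1$ if $\mathsf{P}(X=x)=0$, and $U_X(\omega):=U_{X(\omega)}(\omega)$. The objects $\mathsf{r}_i$ and $(U_i)_{X_i}$ are $\mathsf{r}$ and $U_X$ constructed from $X_i$ and $U_i$ in place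 of $X$ and $U$. *)

(* Defs.v *)
From HB Require Import structures.
From mathcomp Require Import all_boot all_order all_algebra.
From mathcomp Require Import all_classical all_reals all_analysis.

Set Implicit Arguments.
Unset Strict Implicit.
Unset Printing Implicit Defensive.

Import Order.TTheory GRing.Theory Num.Theory.
Import numFieldNormedType.Exports.

Local Open Scope classical_set_scope.
Local Open Scope ring_scope.
Local Open Scope ereal_scope.

Section Independence.
Context d (T : measurableType d) (R : realType) (P : probability T R).

Definition independent_RVs (I : finType) (X : I -> {RV P >-> R}) : Prop :=
  forall (J : {set I}) (A : I -> set R), (forall i, measurable (A i)) ->
    P (\bigcap_(i in [set` J]) (X i @^-1` A i)) =
    \prod_(i in J) P (X i @^-1` A i).

Definition generated_sigma (I : finType) (X : I -> {RV P >-> R}) :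
    set (set T) :=
  <<s \bigcup_(i in [set: I]) preimage_set_system setT (X i) measurable >>.

Definition independent_families (I J : finType)
    (X : I -> {RV P >-> R}) (U : J -> {RV P >-> R}) : Prop :=
  forall A B : set T, generated_sigma X A -> generated_sigma U B ->
    P (A `&` B) = P A * P B.

Definition zero_mean (X : {RV P >-> R}) : Prop :=
  P.-integrable setT (EFin \o X) /\ 'E_P[X] = 0.

Definition uniform01 (U : {RV P >-> R}) : Prop :=
  forall A : set R, measurable A ->
    distribution P U A = uniform_prob (@ltr01 R) A.

End Independence.

Section Reciprocating.
Context d (T : measurableType d) (R : realType) (P : probability T R).
Variable X : {RV P >-> R}.

(* The expectations are finite as soon as X is integrable, so taking [fine]
   loses nothing. *)
Definition G (x : \bar R) : R :=
  if 0 <= x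
  then fine 'E_P[fun w => (X w * \1_[set w | (0 < X w)%R /\ ((X w)%:E <= x)%E] w)%R]
  else fine 'E_P[fun w => (- X w * \1_[set w | (x <= (X w)%:E)%E /\ (X w < 0)%R] w)%R].

Definition x_plus (h : R) : \bar R :=
  ereal_inf [set x : \bar R | 0 <= x /\ (h <= G x)%R].

Definition x_minus (h : R) : \bar R :=
  ereal_sup [set x : \bar R | x <= 0 /\ (h <= G x)%R].

Definition G_left (x : R) : R := lim (G y%:E @[y --> x^'-]).
Definition G_right (x : R) : R := lim (G y%:E @[y --> x^'+]).

Definition H (x u : R) : R :=
  (if 0 <= x then G_left x + u * (G x%:E - G_left x)
   else G_right x + u * (G x%:E - G_right x))%R.

(* Extended-real valued: for instance r(x, 1) = -oo when G(x) = m, x >= 0 and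
   X is essentially unbounded below. *)
Definition reciprocating (x u : R) : \bar R :=
  if (0 <= x)%R then x_minus (H x u) else x_plus (H x u).

Definition randomization (U : {RV P >-> R}) (w : T) : R :=
  if P (X @^-1` [set X w]) != 0 then U w else 1%R.

Definition abs_prod_recip (U : {RV P >-> R}) (w : T) : \bar R :=
  `| (X w)%:E * reciprocating (X w) (randomization U w) |.

End Reciprocating.

Section SelfNormalized.
Context d (T : measurableType d) (R : realType) (P : probability T R).
Context (n : nat) (X U : 'I_n -> {RV P >-> R}) (lambda : R).

(* Division by zero in R yields 0, which implements the rule 0/0 := 0; the
   numerator is almost surely 0 where the denominator is. The value +oo of the
   denominator, attained with probability zero only, is sent to 0 by [fine],
   so that there, too, the ratio is 0 = s / +oo. *)
Definition self_normalized_sum (w : T) : R :=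
  ((\sum_(i < n) X i w) /
   fine ((\sum_(i < n) abs_prod_recip (X i) (U i) w `^ lambda)%E
           `^ (2 * lambda)^-1))%R.

End SelfNormalized.

(* No constraint c <> c': together with zero mean, c = c' forces c = c' = 0,
   the degenerate case. *)
Definition takes_two_values d (T : measurableType d) (R : realType)
    (P : probability T R) (Z : {RV P >-> R}) (c c' : R) : Prop :=
  [/\ forall w, Z w = c \/ Z w = c',
      0 < P (Z @^-1` [set c]) & 0 < P (Z @^-1` [set c'])].

(* The Z's may live on an arbitrary probability space. *)
Definition two_value_expectations (R : realType) (n : nat) (lambda : R)
    (f : R -> R) : set (\bar R) :=
  [set e | exists (d : measure_display) (T : measurableType d)
      (P : probability T R) (Z : 'I_n -> {RV P >-> R}) (c c' : 'I_n -> R),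
    [/\ independent_RVs Z,
        forall i, zero_mean (Z i),
        forall i, takes_two_values (Z i) (c i) (c' i),
        (\sum_(i < n) `|c i * c' i| `^ lambda = 1)%R &
        e = 'E_P[fun w => f (\sum_(i < n) Z i w)%R]]].

(* Main.v *)
From HB Require Import structures.
Require Import Defs.
From mathcomp Require Import all_boot all_order all_algebra.
From mathcomp Require Import all_classical all_reals all_analysis.
From mathcomp Require Import measurable_realfun ring lra.

Set Implicit Arguments.
Unset Strict Implicit.
Unset Printing Implicit Defensive.

Import Order.TTheory GRing.Theory Num.Theory.
Import numFieldNormedType.Exports.

Local Open Scope classical_set_scope.
Local Open Scope ring_scope.
Local Open Scope ereal_scope.

(** Fix one summand [X], and weight [P] by [X^+] and by [X^-]. These two
    measures have the same total mass [m], because [X] is centered, and the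
    function [G] is the distribution function of [X^+] under the first measure
    on the positive half-line and of [X^-] under the second one on the negative
    half-line. Hence [x_plus] and [- x_minus] are the quantile functions of
    these two laws, and [H (X, U)] is the randomized rank of [X]. Under each
    weighted measure the randomized rank is uniform on [(0, m)] and the
    quantile of the rank gives back [X] up to sign ([rank_uniform],
    [quantile_rank]). Therefore, writing [a h] and [b h] for the two quantiles
    at level [h],

      E phi (X, Y) = phi (0, 0) P (X = 0)
        + int_0^m (phi (a, a b) / a + phi (- b, a b) / b) dh,

    which is [disintegration]. The integrand is [1/a + 1/b] times the
    expectation of [phi (Z, a b)], where [Z] is the centered law carried by [a]
    and [- b]: the pair [(X, Y)] is a mixture of pairs [(Z, |c d|)] with [Z]
    centered on two values [c], [d]. So a bound on [E phi (Z, |c d|)] that is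
    uniform in these two-point laws also bounds [E phi (X, Y)]
    ([two_point_bound]).

    The summands are then replaced one at a time. The ratio depends on
    them only through the two sums [sum X_j] and [sum Y_j^lambda]; since the
    pair [(X_k, Y_k)] is independent of the sums over [j > k], integrating
    the latter out first leaves a function [phi] of [(X_k, Y_k)], to which
    [two_point_bound] applies. Conversely an independent centered coin is
    adjoined to a two-point family by taking the product of its space with a
    Bernoulli space. By induction ([tail_comparison]) it is enough to bound the
    expectation when every [X_i] is a two-point variable with values [c_i] and
    [d_i]. In that case the denominator is a constant: either it is zero and
    the sum vanishes, which gives [f 0], or dividing by it turns the family
    into one that satisfies the normalization, which gives an element of the
    set whose supremum is taken. *)

(** * Measures with a density *)

Section density.
Context d (T : measurableType d) (R : realType) (mu : {measure set T -> \bar R}).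
Variable xi : T -> R.

(** Measurability and nonnegativity of the density are arguments so that the
    measure structure can be inferred from the term. *)
Definition density_measure of measurable_fun setT xi & (forall t, (0 <= xi t)%R) :=
  fun A : set T => \int[mu]_(t in A) (xi t)%:E.

Hypotheses (mxi : measurable_fun setT xi) (xi0 : forall t, (0 <= xi t)%R).
Local Notation nu := (density_measure mxi xi0).

Let nu0 : nu set0 = 0. Proof. exact: integral_set0. Qed.

Let nu_ge0 A : 0 <= nu A.
Proof. by apply: integral_ge0 => t _; rewrite lee_fin. Qed.

Let nu_sigma_additive : semi_sigma_additive nu.
Proof.
apply: semi_sigma_additive_nng_induced; last by move=> t; rewrite lee_fin.
exact/measurable_EFinP.
Qed.

HB.instance Definition _ := isMeasure.Build _ _ _ nu
  nu0 nu_ge0 nu_sigma_additive.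

Import HBNNSimple.

Let integral_density_nnsfun (g : {nnsfun T >-> R}) :
  \int[nu]_t (g t)%:E = \int[mu]_t ((xi t)%:E * (g t)%:E).
Proof.
under [LHS]eq_integral do rewrite fimfunE -fsumEFin//.
rewrite [LHS]ge0_integral_fsum//; last 2 first.
  - by move=> r; exact/measurable_EFinP/measurableT_comp.
  - by move=> n x _; rewrite EFinM nnfun_muleindic_ge0.
under [RHS]eq_integral.
  move=> x xD; rewrite fimfunE -fsumEFin// ge0_mule_fsumr; last first.
    by move=> r; rewrite EFinM nnfun_muleindic_ge0.
  over.
rewrite [RHS]ge0_integral_fsum//; last 2 first.
  - move=> r; apply/measurable_EFinP/measurable_funM => //.
    exact: measurable_funM.
  - move=> n x _; rewrite EFinM mule_ge0//; last by rewrite nnfun_muleindic_ge0.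
    by rewrite lee_fin.
apply: eq_fsbigr => r; rewrite inE => -[w _ gr].
have r0 : (0 <= r)%R by rewrite -gr; exact: fun_ge0.
have mgr : measurable (g @^-1` [set r]) by exact: measurable_sfunP.
under eq_integral do rewrite EFinM.
rewrite ge0_integralZl//; last exact/measurable_EFinP/measurable_indic.
rewrite integral_indic// setIT.
transitivity (\int[mu]_x (r%:E * ((xi x)%:E * (\1_(g @^-1` [set r]) x)%:E))).
  rewrite ge0_integralZl//; last 2 first.
  - apply: emeasurable_funM; exact/measurable_EFinP.
  - by move=> x _; rewrite mule_ge0// lee_fin.
  congr (_ * _); rewrite /density_measure /= [LHS]integral_mkcond.
  apply: eq_integral => x _; rewrite patchE indicE.
  by case: ifPn => _; rewrite ?mule1 ?mule0.
by apply: eq_integral => x _; rewrite EFinM muleCA.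
Qed.

Lemma integral_density (g : T -> \bar R) :
  measurable_fun setT g -> (forall t, 0 <= g t) ->
  \int[nu]_t g t = \int[mu]_t ((xi t)%:E * g t).
Proof.
move=> mg g0; pose g_ := nnsfun_approx measurableT mg.
transitivity (lim (\int[nu]_t (g_ n t)%:E @[n --> \oo])).
  rewrite -monotone_convergence//=.
  - apply: eq_integral => ? _; apply/esym/cvg_lim => //=.
    exact: cvg_nnsfun_approx.
  - by move=> n; exact/measurable_EFinP/measurable_funTS.
  - by move=> n ? _; rewrite lee_fin.
  - by move=> ? _ ? ? mn; rewrite lee_fin; exact/lefP/nd_nnsfun_approx.
under eq_fun do rewrite integral_density_nnsfun.
rewrite -monotone_convergence//=.
- apply: eq_integral => t _; apply/cvg_lim => //=.
  by apply: cvgeZl => //; exact: cvg_nnsfun_approx.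
- by move=> n; apply: emeasurable_funM; exact/measurable_EFinP.
- by move=> n t _; rewrite mule_ge0// lee_fin.
- move=> t _ m n mn; rewrite lee_wpmul2l ?lee_fin//.
  exact/lefP/nd_nnsfun_approx.
Qed.

End density.

(** * Distribution functions and quantiles of a finite measure *)

Section finite_measure_limits.
Context d (T : measurableType d) (R : realType) (nu : {measure set T -> \bar R}).
Hypothesis nu_fin : nu setT < +oo.

Lemma finite_measure_fin_num A : measurable A -> nu A \is a fin_num.
Proof.
move=> mA; rewrite ge0_fin_numE// (le_lt_trans _ nu_fin)//.
by rewrite le_measure ?inE.
Qed.

Lemma le_fine_measure A B : measurable A -> measurable B -> A `<=` B ->
  (fine (nu A) <= fine (nu B))%R.
Proof.
by move=> mA mB AB; rewrite fine_le ?finite_measure_fin_num// le_measure ?inE.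
Qed.

(** Continuity from below, read contrapositively: a level exceeded by the limit
    is exceeded at a finite stage. One-sided limits of distribution functions
    are only ever used through this form and its companion for intersections. *)
Lemma lt_fine_measure_bigcup (F : (set T)^nat) (c : R) :
  (forall i, measurable (F i)) -> {homo F : n m / (n <= m)%N >-> n `<=` m} ->
  (c < fine (nu (\bigcup_n F n)))%R -> exists n, (c < fine (nu (F n)))%R.
Proof.
move=> mF ndF; apply: contraPP => /forallNP F_le; apply/negP; rewrite -leNgt.
have mUF : measurable (\bigcup_n F n) by exact: bigcup_measurable.
rewrite -lee_fin fineK ?finite_measure_fin_num//.
have /cvg_lim <- // := @nondecreasing_cvg_mu _ _ _ nu F mF mUF
  (fun n m nm => introT (subsetPset _ _) (ndF n m nm)).
apply: lime_le.
  apply/cvg_ex; eexists; apply: nondecreasing_cvg_mu => // n m nm.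
  exact/subsetPset/ndF.
apply: nearW => n /=; rewrite -(fineK (finite_measure_fin_num (mF n))) lee_fin.
by rewrite leNgt; exact/negP/F_le.
Qed.

Lemma lt_fine_measure_bigcap (F : (set T)^nat) (c : R) :
  (forall i, measurable (F i)) -> {homo F : n m / (n <= m)%N >-> m `<=` n} ->
  (fine (nu (\bigcap_n F n)) < c)%R -> exists n, (fine (nu (F n)) < c)%R.
Proof.
move=> mF ndF; apply: contraPP => /forallNP F_ge; apply/negP; rewrite -leNgt.
have mUF : measurable (\bigcap_n F n) by exact: bigcap_measurable.
rewrite -lee_fin fineK ?finite_measure_fin_num//.
have F0 : nu (F 0%N) < +oo.
  by rewrite -ge0_fin_numE// finite_measure_fin_num.
have /cvg_lim <- // := @nonincreasing_cvg_mu _ _ _ nu F F0 mF mUF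
  (fun n m nm => introT (subsetPset _ _) (ndF n m nm)).
apply: lime_ge.
  apply/cvg_ex; eexists; apply: nonincreasing_cvg_mu => // n m nm.
  exact/subsetPset/ndF.
apply: nearW => n /=; rewrite -(fineK (finite_measure_fin_num (mF n))) lee_fin.
by rewrite leNgt; exact/negP/F_ge.
Qed.

End finite_measure_limits.

Section quantile_defs.
Context d (T : measurableType d) (R : realType) (nu : {measure set T -> \bar R}).
Variable xi : T -> R.

(** The argument is extended because the function [G] has to be evaluated at
    infinity. *)
Definition dist_fun (x : \bar R) : R := fine (nu [set t | (xi t)%:E <= x]).

(** The left limit of the distribution function at [x], as the measure of an
    open ray rather than as a limit, so that it is monotone by inspection. *)
Definition dist_fun_left (x : R) : R := fine (nu [set t | (xi t < x)%R]).

(** The distributional transform: [u] selects a level inside the jump of the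
    distribution function at [x]. *)
Definition randomized_rank (x u : R) : R :=
  (dist_fun_left x + u * (dist_fun x%:E - dist_fun_left x))%R.

(** The infimum runs over [x >= 0] because the laws considered are carried by
    the positive half-line, and over extended reals because a level above the
    total mass is never reached. *)
Definition quantile (h : R) : \bar R :=
  ereal_inf [set x : \bar R | 0 <= x /\ (h <= dist_fun x)%R].

End quantile_defs.

Section quantile_basics.
Context d (T : measurableType d) (R : realType) (nu : {measure set T -> \bar R}).
Variable xi : T -> R.
Hypotheses (nu_fin : nu setT < +oo) (mxi : measurable_fun setT xi).

Local Notation F := (dist_fun nu xi).
Local Notation F' := (dist_fun_left nu xi).
Local Notation Q := (quantile nu xi).
Local Notation mass := (fine (nu setT)).

Lemma measurable_sub_le (x : \bar R) : measurable [set t | (xi t)%:E <= x].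
Proof.
case: x => [x| |].
- rewrite (_ : [set _ | _] = xi @^-1` `]-oo, x]); last first.
    by apply/seteqP; split => t /=; rewrite in_itv/= lee_fin.
  by rewrite -[X in measurable X]setTI; exact: mxi.
- by rewrite (_ : [set _ | _] = setT)//; apply/seteqP; split => t //=; rewrite leey.
- by rewrite (_ : [set _ | _] = set0)//; apply/seteqP; split => t //=.
Qed.

Lemma measurable_sub_lt (x : R) : measurable [set t | (xi t < x)%R].
Proof.
rewrite (_ : [set _ | _] = xi @^-1` `]-oo, x[); last first.
  by apply/seteqP; split => t /=; rewrite in_itv.
by rewrite -[X in measurable X]setTI; exact: mxi.
Qed.

Lemma measurable_sub_eq (x : R) : measurable [set t | xi t = x].
Proof.
rewrite (_ : [set _ | _] = xi @^-1` [set x])//.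
by rewrite -[X in measurable X]setTI; exact: mxi.
Qed.

#[local] Hint Resolve measurable_sub_le measurable_sub_lt measurable_sub_eq : core.

Lemma dist_fun_homo x y : x <= y -> (F x <= F y)%R.
Proof.
move=> xy; apply: le_fine_measure => // t /= /le_trans.
exact.
Qed.

Lemma dist_fun_left_homo x y : (x <= y)%R -> (F' x <= F' y)%R.
Proof.
move=> xy; apply: le_fine_measure => // t /= /lt_le_trans.
exact.
Qed.

Lemma dist_fun_left_le x : (F' x <= F x%:E)%R.
Proof.
by apply: le_fine_measure => // t /= xt; rewrite lee_fin ltW.
Qed.

Lemma dist_fun_le_left x y : (x < y)%R -> (F x%:E <= F' y)%R.
Proof.
move=> xy; apply: le_fine_measure => // t /=.
by rewrite lee_fin => /le_lt_trans; exact.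
Qed.

Lemma dist_fun_ge0 x : (0 <= F x)%R.
Proof. exact: fine_ge0. Qed.

Lemma dist_fun_le_mass x : (F x <= mass)%R.
Proof. exact: le_fine_measure. Qed.

Lemma dist_fun_jump x :
  (F x%:E - F' x = fine (nu [set t | xi t = x]))%R.
Proof.
rewrite /dist_fun (_ : [set _ | _] =
    [set t | (xi t < x)%R] `|` [set t | xi t = x]); last first.
  apply/seteqP; split => t /=; rewrite lee_fin le_eqVlt.
    by move=> /orP[/eqP|]; [right|left].
  by move=> [->|->]; rewrite ?eqxx ?orbT.
rewrite measureU//; last first.
  by rewrite -subset0 => t [/= + tx]; rewrite tx ltxx.
by rewrite fineD ?(finite_measure_fin_num nu_fin)// addrAC subrr add0r.
Qed.

(** Left limits: the open ray below [x] is the union of the closed rays below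
    [x - 1/(n+1)]. *)
Lemma lt_dist_fun_left (c x : R) : (c < F' x)%R ->
  exists2 y, (y < x)%R & (c < F y%:E)%R.
Proof.
rewrite /dist_fun_left (_ : [set _ | _] =
    \bigcup_n [set t | (xi t)%:E <= (x - n.+1%:R^-1)%:E]); last first.
  apply/seteqP; split => [t /= /ltr_add_invr[k tk]|t [k _] /=].
    by exists k => //=; rewrite lee_fin lerBrDr ltW.
  rewrite lee_fin => /le_lt_trans; apply.
  by rewrite ltrBlDr ltrDl.
move=> /(lt_fine_measure_bigcup nu_fin) [k|n m nm t /=|k tk].
- by [].
- rewrite !lee_fin => /le_trans; apply; rewrite lerD2l lerN2.
  by rewrite lef_pV2 ?posrE// ler_nat.
by exists (x - k.+1%:R^-1)%R => //; rewrite ltrBlDr ltrDl.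
Qed.

(** Right-continuity: the closed ray below [x] is the intersection of the
    closed rays below [x + 1/(n+1)]. *)
Lemma lt_dist_fun_right (c x : R) : (F x%:E < c)%R ->
  exists2 y, (x < y)%R & (F y%:E < c)%R.
Proof.
rewrite {1}/dist_fun (_ : [set _ | _] =
    \bigcap_n [set t | (xi t)%:E <= (x + n.+1%:R^-1)%:E]); last first.
  apply/seteqP; split => [t /= tx k _ /=|t xt /=].
    by rewrite (le_trans tx)// lee_fin lerDl.
  rewrite leNgt; apply/negP; rewrite lte_fin => /ltr_add_invr[k].
  by apply/negP; rewrite -leNgt -lee_fin; exact: xt.
move=> /(lt_fine_measure_bigcap nu_fin) [k|n m nm t /=|k tk].
- by [].
- rewrite !lee_fin => /le_trans; apply; rewrite lerD2l.
  by rewrite lef_pV2 ?posrE// ler_nat.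
by exists (x + k.+1%:R^-1)%R => //; rewrite ltrDl.
Qed.

Lemma lt_dist_fun_mass (c : R) : (c < mass)%R ->
  exists2 y, (0 <= y)%R & (c < F y%:E)%R.
Proof.
rewrite (_ : setT = \bigcup_n [set t | (xi t)%:E <= n%:R%:E]); last first.
  apply/seteqP; split => [t _ /=|//].
  exists (Num.truncn `|xi t|).+1 => //=; rewrite lee_fin ltW//.
  by rewrite (le_lt_trans (ler_norm _))// truncnS_gt.
move=> /(lt_fine_measure_bigcup nu_fin) [k|n m nm t /=|k tk].
- by [].
- by rewrite !lee_fin => /le_trans; apply; rewrite ler_nat.
by exists k%:R.
Qed.

Lemma quantile_ge0 h : 0 <= Q h.
Proof. by apply/ereal_infP => y []. Qed.

Lemma quantile_homo h k : (h <= k)%R -> Q h <= Q k.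
Proof.
by move=> hk; apply: ereal_inf_le_tmp => x /= [x0 kx]; split; rewrite ?(le_trans hk).
Qed.

(** A monotone function pulls rays back to intervals. *)
Lemma measurable_quantile : measurable_fun setT Q.
Proof.
apply: (measurability (@ErealGenCInfty.G R)) => [|/= _ [_] [r] -> <-].
  exact: ErealGenCInfty.measurableE.
rewrite setTI; apply: is_interval_measurable => s t /=.
rewrite !in_itv/= !andbT => fs ft u /andP[su ut].
by rewrite in_itv/= andbT (le_trans fs)// quantile_homo.
Qed.

Lemma measurable_dist_fun : measurable_fun setT (fun x : R => F x%:E).
Proof.
by apply: nondecreasing_measurable => // x y xy; apply: dist_fun_homo; rewrite lee_fin.
Qed.

Lemma measurable_dist_fun_left : measurable_fun setT F'.
Proof.
by apply: nondecreasing_measurable => // x y xy; apply: dist_fun_left_homo.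
Qed.

Lemma measurable_randomized_rank :
  measurable_fun setT (fun p : R * R => randomized_rank nu xi p.1 p.2).
Proof.
have m1 : measurable_fun setT (fun p : R * R => F' p.1).
  by apply: (measurableT_comp measurable_dist_fun_left); exact: measurable_fst.
apply: measurable_funD => //; apply: measurable_funM => //.
apply: measurable_funB => //.
by apply: (measurableT_comp measurable_dist_fun); exact: measurable_fst.
Qed.

(** Finiteness comes from the levels below the mass being reached, the bounds at
    [s] from the one-sided continuity of the distribution function, and [s > 0]
    from the absence of mass on the negative half-line. *)
Lemma quantile_spec h : nu [set t | (xi t <= 0)%R] = 0 ->
  (0 < h < mass)%R ->
  exists2 s : R, Q h = s%:E &
    [/\ (0 < s)%R, (F' s <= h <= F s%:E)%R,
        forall x, (x < s)%R -> (F x%:E < h)%R &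
        forall x, (s < x)%R -> (h <= F x%:E)%R].
Proof.
move=> nu_le0 /andP[h0 hm].
have [y y0 hy] := lt_dist_fun_mass hm.
have Qy : Q h <= y%:E.
  by apply: ge_ereal_inf; exists y%:E => //; split => //; rewrite ltW.
have Qfin : Q h \is a fin_num.
  by rewrite ge0_fin_numE ?quantile_ge0// (le_lt_trans Qy)// ltry.
have [s Qs] : exists s, Q h = s%:E by exists (fine (Q h)); rewrite fineK.
have s0 : (0 <= s)%R by rewrite -lee_fin -Qs quantile_ge0.
have F0 x : (x <= 0)%R -> (F x%:E < h)%R.
  move=> x0; rewrite (le_lt_trans _ h0)//; apply: le_trans.
    by apply: (@dist_fun_homo _ 0); rewrite lee_fin.
  rewrite /dist_fun (_ : [set _ | _] = [set t | (xi t <= 0)%R]) ?nu_le0//.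
have lts x : (x < s)%R -> (F x%:E < h)%R.
  move=> xs; have [/F0//|x0] := leP x 0%R; rewrite ltNge; apply/negP => hx.
  have : Q h <= x%:E.
    by apply: ge_ereal_inf; exists x%:E => //; split => //; rewrite lee_fin ltW.
  by rewrite Qs lee_fin leNgt xs.
have gts x : (s < x)%R -> (h <= F x%:E)%R.
  rewrite -lte_fin -Qs => /ereal_inf_lt[z [z0 hz] zx].
  by rewrite (le_trans hz)// dist_fun_homo// ltW.
have hFs : (h <= F s%:E)%R.
  rewrite leNgt; apply/negP => /lt_dist_fun_right[x sx].
  by rewrite ltNge gts.
exists s => //; split => //.
- rewrite lt_neqAle s0 andbT; apply/eqP => s00.
  by have := F0 s; rewrite -s00 lexx ltNge -?s00 => /(_ isT); rewrite s00 hFs.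
- rewrite hFs andbT leNgt; apply/negP => /lt_dist_fun_left[x /lts].
  by move=> /ltW; rewrite leNgt => /negP.
Qed.

End quantile_basics.

(** * The randomized probability integral transform *)

Section randomized_transform.
Context d (T : measurableType d) (R : realType) (nu : {measure set T -> \bar R}).
Variables xi U : T -> R.
Hypotheses (nu_fin : nu setT < +oo) (mxi : measurable_fun setT xi).
Hypotheses (mU : measurable_fun setT U)
  (nu_le0 : nu [set t | (xi t <= 0)%R] = 0)
  (nu_U01 : nu [set t | ~ (0 <= U t <= 1)%R] = 0)
  (nu_atom : forall x u : R, (0 <= u <= 1)%R ->
     nu ([set t | xi t = x] `&` [set t | (U t < u)%R]) =
     u%:E * nu [set t | xi t = x]).

Local Notation F := (dist_fun nu xi).
Local Notation F' := (dist_fun_left nu xi).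
Local Notation Q := (quantile nu xi).
Local Notation mass := (fine (nu setT)).
Local Notation W := (fun t => randomized_rank nu xi (xi t) (U t)).

Let U01 := [set t | (0 <= U t <= 1)%R].

Lemma measurable_rank : measurable_fun setT W.
Proof.
apply: (measurableT_comp (measurable_randomized_rank nu_fin mxi)
  (g := fun t => (xi t, U t))).
exact: measurable_fun_pair.
Qed.

Lemma rank_bounds t : U01 t -> (F' (xi t) <= W t <= F (xi t)%:E)%R.
Proof.
rewrite /U01/= /randomized_rank => /andP[u0 u1].
have := dist_fun_left_le nu_fin mxi (xi t).
by set a := F' _; set b := F _ => ab; apply/andP; split; nra.
Qed.

Let mU01 : measurable (~` U01).
Proof.
apply: measurableC; rewrite (_ : U01 = U @^-1` `[0%R, 1%R]); last first.
  by apply/seteqP; split => t; rewrite /U01/= in_itv.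
by rewrite -[X in measurable X]setTI; exact: mU.
Qed.

Let le_nu_U01 A B : measurable A -> measurable B -> A `&` U01 `<=` B ->
  nu A <= nu B.
Proof.
move=> mA mB AB; have mBU : measurable (B `|` ~` U01) by exact: measurableU.
apply: (@le_trans _ _ (nu (B `|` ~` U01))).
  rewrite le_measure ?inE// => t At.
  by have [Ut|Ut] := pselect (U01 t); [left; exact: AB|right].
by rewrite (le_trans (measureU2 _ _ _))// [X in _ + X](_ : _ = 0) ?adde0.
Qed.

(** With [s] the quantile at level [h], the rank is below [h] when [xi < s],
    at least [h] when [xi > s], and on [xi = s] the comparison is one between [U]
    and the relative position [u] of [h] in the jump at [s]. This event has
    measure [F' s + u * (F s - F' s) = h]. The two inclusions differ in their
    inequalities because ranks may equal [h] on flat pieces of [F]. *)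
Lemma rank_event h : (0 < h < mass)%R ->
  exists E : set T, [/\ measurable E, nu E = h%:E,
    [set t | (W t < h)%R] `&` U01 `<=` E &
    E `&` U01 `<=` [set t | (W t <= h)%R]].
Proof.
move=> hm; have [s Qs [s0 /andP[F'h hF] lts gts]] :=
  quantile_spec nu_fin mxi nu_le0 hm.
pose D := (F s%:E - F' s)%R.
have D0 : (0 <= D)%R by rewrite subr_ge0 (le_trans F'h).
(* If there is no jump then division by zero gives u = 0, and h = F' s. *)
pose u := ((h - F' s) / D)%R.
have uD : (F' s + u * D = h)%R.
  have [D00|D00] := eqVneq D 0%R.
    rewrite D00 mulr0 addr0; apply/eqP; rewrite eq_le F'h/= (le_trans hF)//.
    by rewrite -subr_le0 -/D D00.
  by rewrite /u -mulrA mulVf// mulr1 subrKC.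
have u01 : (0 <= u <= 1)%R.
  have [D00|D00] := eqVneq D 0%R; first by rewrite /u D00 invr0 mulr0 lexx ler01.
  have {D00}D0 : (0 < D)%R by rewrite lt_neqAle eq_sym D00.
  rewrite /u divr_ge0 ?(ltW D0) ?subr_ge0//= ler_pdivrMr// mul1r.
  by rewrite lerD2r.
have mEs : measurable [set t | xi t = s] by exact: measurable_sub_eq.
have mEU : measurable [set t | (U t < u)%R] by exact: measurable_sub_lt.
have mlt : measurable [set t | (xi t < s)%R] by exact: measurable_sub_lt.
exists ([set t | (xi t < s)%R] `|` ([set t | xi t = s] `&` [set t | (U t < u)%R])).
split.
- by apply: measurableU => //; exact: measurableI.
- rewrite measureU//; [|exact: measurableI|]; last first.
    by rewrite -subset0 => t [/= + [ts _]]; rewrite ts ltxx.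
  rewrite [X in _ + X]nu_atom// -uD EFinD; congr (_ + _).
    exact/esym/fineK/finite_measure_fin_num.
rewrite [RHS]EFinM; congr (_ * _); rewrite /D (dist_fun_jump nu_fin mxi).
  exact/esym/fineK/finite_measure_fin_num.
- move=> t [/= Wh Ut]; have /andP[F'W WF] := rank_bounds Ut.
  have [ts|ts|ts] := ltgtP (xi t) s; first by left.
    exfalso; move: Wh; apply/negP; rewrite -leNgt (le_trans _ F'W)//.
    have [st1 st2] := midf_lt ts.
    apply: le_trans (dist_fun_le_left nu_fin mxi st2); exact: gts.
  right; split => //=; move: Wh; rewrite /randomized_rank ts -/D -uD.
  rewrite ltrD2l => uu; rewrite ltNge; apply/negP => uU.
  by move: uu; apply/negP; rewrite -leNgt ler_wpM2r.
- move=> t [/= [ts|[ts tu]] Ut]; have /andP[F'W WF] := rank_bounds Ut.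
    by rewrite (le_trans WF)// ltW// lts.
  by rewrite /randomized_rank ts -/D -uD lerD2l ler_wpM2r// ltW.
Qed.

Let mWlt h : measurable [set t | (W t < h)%R].
Proof. exact: measurable_sub_lt measurable_rank _. Qed.

Let mWle h : measurable [set t | (W t <= h)%R].
Proof.
have := measurable_sub_le measurable_rank h%:E.
by under [X in measurable X]eq_set do rewrite lee_fin.
Qed.

Let rank_lt_le h : (0 < h < mass)%R -> nu [set t | (W t < h)%R] <= h%:E.
Proof. by move=> /rank_event[E [mE <- WE _]]; exact: le_nu_U01. Qed.

Let rank_le_ge h : (0 < h < mass)%R -> h%:E <= nu [set t | (W t <= h)%R].
Proof. by move=> /rank_event[E [mE <- _ WE]]; exact: le_nu_U01. Qed.

Let mass_ge0 : (0 <= mass)%R. Proof. exact: fine_ge0. Qed.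

(** [rank_event] bounds [nu (W < h)] from above and [nu (W <= h)] from below;
    comparing with slightly smaller levels closes the gap. *)
Lemma rank_lt_measure h : (0 < h <= mass)%R ->
  nu [set t | (W t < h)%R] = h%:E.
Proof.
move=> /andP[h0 hm]; apply/eqP; rewrite eq_le; apply/andP; split.
  have [->|hm'] := eqVneq h mass.
    rewrite fineK ?(finite_measure_fin_num nu_fin)// le_measure ?inE//.
  by rewrite rank_lt_le// h0 lt_neqAle hm'.
apply/lee_subgt0Pr => e e0.
pose k := Num.max (h / 2)%R (h - e)%R.
have k0 : (0 < k)%R by rewrite lt_max divr_gt0.
have kh : (k < h)%R by rewrite gt_max gtrBl e0 andbT ltr_pdivrMr// ltr_pMr// ltr1n.
apply: (@le_trans _ _ k%:E); first by rewrite -EFinB lee_fin le_max lexx orbT.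
rewrite (le_trans (rank_le_ge _))//; first by rewrite k0 (lt_le_trans kh).
rewrite le_measure ?inE// => t /= tk; exact: le_lt_trans kh.
Qed.

(** The rank has the same distribution function as a uniform variable, and
    open left rays are a generating pi-system. *)
Lemma rank_uniform (A : set R) : measurable A ->
  pushforward nu W A = lebesgue_measure (A `&` `]0%R, mass[).
Proof.
have mD : measurable (`]0%R, mass[ : set R) by exact: measurable_itv.
have mlt h : nu [set t | (W t < h)%R] =
    lebesgue_measure (`]-oo, h[ `&` `]0%R, mass[ : set R).
  have [h0|h0] := leP h 0%R.
    rewrite [X in lebesgue_measure X](_ : _ = set0) ?measure0; last first.
      apply/seteqP; split => x //=; rewrite !in_itv/= => -[xh /andP[x0 _]].
      by move: (lt_trans x0 xh); rewrite ltNge h0.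
    have [m0|m0] := eqVneq mass 0%R.
      apply/eqP; rewrite eq_le measure_ge0 andbT.
      apply: (@le_trans _ _ (nu setT)); first by rewrite le_measure ?inE.
      by rewrite -[nu setT]fineK ?m0// finite_measure_fin_num.
    have {}m0 : (0 < mass)%R by rewrite lt_neqAle eq_sym m0.
    apply/eqP; rewrite eq_le measure_ge0 andbT; apply/lee_addgt0Pr => e e0.
    pose k := Num.min mass e; have k0 : (0 < k)%R by rewrite lt_min m0.
    apply: (@le_trans _ _ (nu [set t | (W t < k)%R])).
      rewrite le_measure ?inE// => t /= th; rewrite (lt_trans th)//.
      exact: le_lt_trans k0.
    rewrite rank_lt_measure ?k0 ?ge_min ?lexx// add0e lee_fin.
    by rewrite ge_min lexx orbT.
  have [hm|hm] := leP h mass.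
    rewrite rank_lt_measure ?h0// (_ : _ `&` _ = `]0%R, h[%classic).
      by rewrite lebesgue_measure_itv/= lte_fin h0 sube0.
    apply/seteqP; split => x /=; rewrite !in_itv/=.
      by move=> [xh /andP[-> _]].
    by move=> /andP[-> xh]; rewrite xh (lt_le_trans xh).
  rewrite (_ : _ `&` _ = `]0%R, mass[%classic); last first.
    apply/seteqP; split => x /=; rewrite !in_itv/=; first by case.
    by move=> /andP[-> xm]; rewrite xm (lt_trans xm).
  rewrite lebesgue_measure_itv/= lte_fin.
  have [m0|m0] := ltP 0%R mass.
    rewrite sube0; apply/eqP; rewrite eq_le; apply/andP; split.
      rewrite fineK ?(finite_measure_fin_num nu_fin)// le_measure ?inE//.
    rewrite -(@rank_lt_measure mass) ?m0 ?lexx// le_measure ?inE// => t /=.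
    by move=> tm; exact: lt_trans hm.
  apply/eqP; rewrite eq_le measure_ge0 andbT.
  apply: (@le_trans _ _ (nu setT)); first by rewrite le_measure ?inE.
  by rewrite -[nu setT]fineK ?lee_fin ?(finite_measure_fin_num nu_fin).
move=> mA; 
have mW : measurable_fun setT (W : T -> measurableTypeR R) := measurable_rank.
pose m1 : {measure set (measurableTypeR R) -> \bar R} :=
  measure_function_pushforward__canonical__measure_function_Measure nu mW.
have := @measure_unique _ R (measurableTypeR R) (@RGenInftyO.G R)
  (fun k => `]-oo, k%:R[%classic) (@RGenInftyO.measurableE R) _ _ _ m1
  (mrestr lebesgue_measure mD) _ _ A mA.
apply.
- move=> _ _ [x ->] [y ->]; exists (Num.min x y).
  by apply/seteqP; split => z /=; rewrite !in_itv/= lt_min => /andP.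
- by move=> k; exists k%:R.
- apply/seteqP; split => // x _; exists (Num.truncn `|x|).+1 => //=.
  by rewrite in_itv/= (le_lt_trans (ler_norm _))// truncnS_gt.
- move=> _ [x ->]; apply: etrans (mlt x).
  by congr (nu _); apply/seteqP; split => t /=; rewrite in_itv.
- move=> k; have -> : m1 `]-oo, k%:R[%classic = nu [set t | (W t < k%:R)%R].
    by congr (nu _); apply/seteqP; split => t /=; rewrite in_itv.
  by rewrite (le_lt_trans _ nu_fin)// le_measure ?inE.
Qed.

Let rank_le_measure h : (0 <= h <= mass)%R -> nu [set t | (W t <= h)%R] <= h%:E.
Proof.
move=> /andP[h0 hm]; have [->|hm'] := eqVneq h mass.
  by rewrite fineK ?(finite_measure_fin_num nu_fin)// le_measure ?inE.
have {hm'}hm : (h < mass)%R by rewrite lt_neqAle hm'.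
apply/lee_addgt0Pr => e e0; pose k := Num.min mass (h + e)%R.
have hk : (h < k)%R by rewrite lt_min hm ltrDl.
apply: (@le_trans _ _ (nu [set t | (W t < k)%R])).
  by rewrite le_measure ?inE// => t /= /le_lt_trans; exact.
rewrite rank_lt_measure ?(le_lt_trans h0) ?ge_min ?lexx//.
by rewrite -EFinD lee_fin ge_min lexx orbT.
Qed.

(** For every [q] the event [xi <= q] lies, up to a null set, inside the event
    that the rank is at most [F q], and both have measure [F q]; the exceptional
    set is the union of their differences over rational [q]. *)
Lemma quantile_rank : {ae nu, forall t, Q (W t) = (xi t)%:E}.
Proof.
pose N (q : rat) :=
  [set t | (W t <= F (ratr q)%:E)%R] `\` [set t | (xi t)%:E <= (ratr q)%:E].
have mle x : measurable [set t | (xi t)%:E <= x] by exact: measurable_sub_le.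
have nuN q : nu.-negligible (N q).
  apply/negligibleP; first exact: measurableD.
  apply/eqP; rewrite eq_le measure_ge0 andbT measureD//; last first.
    by rewrite (le_lt_trans _ nu_fin)// le_measure ?inE.
  rewrite sube_le0; apply: (@le_trans _ _ (F (ratr q)%:E)%:E).
    by rewrite rank_le_measure// dist_fun_ge0 dist_fun_le_mass.
  rewrite fineK; last exact: finite_measure_fin_num.
  apply: le_nu_U01 => //; first exact: measurableI.
  move=> t [/= tq tU]; split => //=; have /andP[_ /le_trans] := rank_bounds tU.
  by apply; exact: dist_fun_homo.
pose M n := oapp N set0 (unpickle n).
have nuM : nu.-negligible (\bigcup_n M n `|` ~` U01 `|` [set t | (xi t <= 0)%R]).
  apply: negligibleU; [apply: negligibleU|].
  - apply: negligible_bigcup => n; rewrite /M.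
    by case: unpickle => //= ; exact: negligible_set0.
  - by apply/negligibleP.
  - by apply/negligibleP => //; have := mle 0; under eq_set do rewrite lee_fin.
suff: nu.-negligible (~` [set t | Q (W t) = (xi t)%:E]) by [].
apply: negligibleS nuM => t /= tQ.
apply: contrapT => /not_orP[/not_orP[tN tU] xi0]; apply: tQ.
move/contrapT: tU => tU.
have {xi0}xi0 : (0 < xi t)%R by rewrite ltNge; exact/negP.
apply/eqP; rewrite eq_le; apply/andP; split.
  apply: ge_ereal_inf; exists (xi t)%:E => //=; split; first by rewrite lee_fin ltW.
  by have /andP[] := rank_bounds tU.
apply/ereal_infP => -[y| |] [//= y0 Wy]; last by rewrite leey.
rewrite lee_fin leNgt; apply/negP => /rat_in_itvoo[q]; rewrite in_itv/= => /andP[yq qx].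
apply: tN; exists (pickle q); [exact: Logic.I|rewrite /M pickleK; split => /=].
  by rewrite (le_trans Wy)// dist_fun_homo// lee_fin ltW.
by apply/negP; rewrite -ltNge lte_fin.
Qed.

(** By [quantile_rank] the value of [xi] can be replaced by the quantile of the
    rank, after which everything depends on the rank alone, which is uniform. *)
Lemma integral_quantile (g : R -> \bar R -> \bar R) :
  measurable_fun setT (fun p : R * \bar R => g p.1 p.2) ->
  (forall h x, 0 <= g h x) ->
  \int[nu]_t g (W t) (xi t)%:E =
  \int[lebesgue_measure]_(h in `]0%R, mass[) g h (Q h).
Proof.
move=> mg g0.
have mQ : measurable_fun setT Q by exact: measurable_quantile.
have mgQ : measurable_fun setT (fun h => g h (Q h)).
  apply: (measurableT_comp mg (g := fun h => (h, Q h))).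
  exact: measurable_fun_pair.
transitivity (\int[nu]_t g (W t) (Q (W t))).
  apply: ae_eq_integral => //.
  - apply: (measurableT_comp mg (g := fun t => (W t, (xi t)%:E))).
    apply: measurable_fun_pair; [exact: measurable_rank|exact/measurable_EFinP].
  - exact: (measurableT_comp mgQ measurable_rank).
  - by apply: filterS quantile_rank => t + _ => <-.
have mW : measurable_fun setT (W : T -> measurableTypeR R) := measurable_rank.
have mD : measurable (`]0%R, mass[ : set (measurableTypeR R)) by exact: measurable_itv.
pose m1 : {measure set (measurableTypeR R) -> \bar R} :=
  measure_function_pushforward__canonical__measure_function_Measure nu mW.
have mgQ' : measurable_fun setT (fun h : measurableTypeR R => g h (Q h)) := mgQ.
transitivity (\int[m1]_h g h (Q h)).
  exact/esym/(@ge0_integral_pushforward _ _ _ (measurableTypeR R)).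
rewrite -(setUv `]0%R, mass[%classic) ge0_integral_setU//=; last 3 first.
- exact: measurableC.
- by rewrite setUv.
- exact/disj_setPCl.
rewrite [X in _ + X]null_set_integral ?adde0; last 3 first.
- exact: measurableC.
- exact: measurable_funTS.
- apply: (etrans (rank_uniform (measurableC mD))).
  by rewrite setICl measure0.
apply: eq_measure_integral => A mA AD.
by apply: (etrans (rank_uniform mA)); rewrite setIidl.
Qed.

End randomized_transform.
(** * Weighted measures and a uniform randomization *)

Section uniform01_facts.
Context d (T : measurableType d) (R : realType) (P : probability T R).
Variable U : {RV P >-> R}.
Hypothesis U_unif : uniform01 U.

Lemma uniform01_preimage (A : set R) : measurable A ->
  P (U @^-1` A) = lebesgue_measure (A `&` `[0%R, 1%R]).
Proof.
move=> mA; rewrite -[LHS]/(distribution P U A) U_unif//.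
rewrite /uniform_prob integral_uniform_pdf.
rewrite (eq_integral (fun=> 1)); last first.
  move=> x; rewrite inE/= => -[_]; rewrite in_itv/= /uniform_pdf => ->.
  by rewrite subr0 invr1.
rewrite integral_cst ?mul1e//.
exact: (@measurableI _ (measurableTypeR R)).
Qed.

Lemma uniform01_lt (u : R) : (0 <= u <= 1)%R -> P [set t | (U t < u)%R] = u%:E.
Proof.
move=> /andP[u0 u1]; rewrite (_ : [set _ | _] = U @^-1` `]-oo, u[); last first.
  by apply/seteqP; split => t /=; rewrite in_itv.
rewrite uniform01_preimage//.
rewrite (_ : _ `&` _ = `[0%R, u[%classic); last first.
  apply/seteqP; split => x /=; rewrite !in_itv/=.
    by move=> [-> /andP[->]].
  by move=> /andP[-> xu]; rewrite xu (ltW (lt_le_trans xu u1)).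
rewrite lebesgue_measure_itv/= lte_fin; case: ltP => [|u00].
  by rewrite sube0.
by apply/eqP; rewrite eq_sym eqe eq_le u0 u00.
Qed.

Lemma uniform01_ae : P [set t | ~ (0 <= U t <= 1)%R] = 0.
Proof.
rewrite (_ : [set _ | _] = U @^-1` (~` `[0%R, 1%R])); last first.
  by apply/seteqP; split => t /=; rewrite in_itv.
rewrite uniform01_preimage; last by apply: measurableC; exact: measurable_itv.
by rewrite setICl measure0.
Qed.

End uniform01_facts.

Section weighted_law.
Context d (T : measurableType d) (R : realType) (P : probability T R).
Variables (xi : T -> R) (U : {RV P >-> R}).
Hypotheses (mxi : measurable_fun setT xi) (xi0 : forall t, (0 <= xi t)%R).
Hypotheses (xi_int : P.-integrable setT (EFin \o xi)) (U_unif : uniform01 U).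
Hypothesis xi_U : forall x u : R,
  P ([set t | xi t = x] `&` [set t | (U t < u)%R]) =
  P [set t | xi t = x] * P [set t | (U t < u)%R].

Local Notation nu := (density_measure P mxi xi0).

Lemma density_fin : nu setT < +oo.
Proof.
have /integrableP[_] := xi_int.
by under eq_integral do rewrite /= ger0_norm//.
Qed.

Lemma density_null A : measurable A -> P A = 0 -> nu A = 0.
Proof.
move=> mA PA; apply: null_set_integral => //.
by apply/measurable_EFinP; exact: measurable_funTS.
Qed.

Lemma density_le0 : nu [set t | (xi t <= 0)%R] = 0.
Proof.
apply: integral0_eq => t /= xt; congr EFin.
by apply/eqP; rewrite eq_le xt xi0.
Qed.

Lemma density_U01 : nu [set t | ~ (0 <= U t <= 1)%R] = 0.
Proof.
apply: density_null; last exact: uniform01_ae.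
rewrite (_ : [set _ | _] = U @^-1` (~` `[0%R, 1%R])); last first.
  by apply/seteqP; split => t /=; rewrite in_itv.
rewrite -[X in measurable X]setTI; apply: measurable_funPT => //.
by apply: measurableC; exact: measurable_itv.
Qed.

Let density_eq x A : measurable A -> A `<=` [set t | xi t = x] ->
  nu A = x%:E * P A.
Proof.
move=> mA Ax; rewrite /= /density_measure (eq_integral (cst x%:E)) ?integral_cst//.
by move=> t; rewrite inE => /Ax /= ->.
Qed.

(** On the atom [xi = x] the weight is the constant [x], so the independence of
    [xi] and [U] under [P] carries over to the weighted measure. *)
Lemma density_atom x u : (0 <= u <= 1)%R ->
  nu ([set t | xi t = x] `&` [set t | (U t < u)%R]) =
  u%:E * nu [set t | xi t = x].
Proof.
move=> u01; have mx := measurable_sub_eq mxi x.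
have mU := measurable_sub_lt (measurable_funPT U) u.
rewrite !(@density_eq x)//; last exact: measurableI.
by rewrite xi_U uniform01_lt// muleA [RHS]muleC.
Qed.

End weighted_law.

(** * The reciprocating function as a quantile *)

Section reciprocating_quantile.
Context d (T : measurableType d) (R : realType) (P : probability T R).
Variable X : {RV P >-> R}.
Hypothesis X_int : P.-integrable setT (EFin \o X).

Local Notation xp := (X^\+%R).
Local Notation xn := (X^\-%R).

Lemma measurable_pos_part : measurable_fun setT xp.
Proof. exact: measurable_funrpos. Qed.

Lemma measurable_neg_part : measurable_fun setT xn.
Proof. exact: measurable_funrneg. Qed.

Lemma pos_part_ge0 t : (0 <= xp t)%R.
Proof. exact: funrpos_ge0. Qed.

Lemma neg_part_ge0 t : (0 <= xn t)%R.
Proof. exact: funrneg_ge0. Qed.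

Lemma integrable_pos_part : P.-integrable setT (EFin \o xp).
Proof.
apply: le_integrable X_int => //.
  by apply/measurable_EFinP; exact: measurable_pos_part.
move=> t _ /=; rewrite lee_fin ger0_norm ?pos_part_ge0// /funrpos.
by rewrite ge_max normr_ge0 ler_norm.
Qed.

Lemma integrable_neg_part : P.-integrable setT (EFin \o xn).
Proof.
apply: le_integrable X_int => //.
  by apply/measurable_EFinP; exact: measurable_neg_part.
move=> t _ /=; rewrite lee_fin ger0_norm ?neg_part_ge0// /funrneg.
by rewrite ge_max normr_ge0 -normrN ler_norm.
Qed.

(** The function [G] on the positive half-line is the distribution function of
    [X^+] under this measure; [neg_measure] is its mirror image. *)
Definition pos_measure : {measure set T -> \bar R} :=
  density_measure P measurable_pos_part pos_part_ge0.

Definition neg_measure : {measure set T -> \bar R} :=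
  density_measure P measurable_neg_part neg_part_ge0.

Let pos_fin : pos_measure setT < +oo.
Proof. exact/density_fin/integrable_pos_part. Qed.

Let neg_fin : neg_measure setT < +oo.
Proof. exact/density_fin/integrable_neg_part. Qed.

Local Notation Fp := (dist_fun pos_measure xp).
Local Notation Fp' := (dist_fun_left pos_measure xp).
Local Notation Fn := (dist_fun neg_measure xn).
Local Notation Fn' := (dist_fun_left neg_measure xn).
Local Notation Qp := (quantile pos_measure xp).
Local Notation Qn := (quantile neg_measure xn).

Lemma G_pos (x : \bar R) : 0 <= x -> G X x = Fp x.
Proof.
move=> x0; rewrite /G x0 /dist_fun; congr fine.
rewrite unlock /= /density_measure [RHS]integral_mkcond.
apply: eq_integral => t _; rewrite patchE /funrpos indicE.
case: ifPn; rewrite ?inE ?notin_setE /= => tx;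
  case: (boolP (t \in [set w | (0 < X w)%R /\ (X w)%:E <= x])) => /=.
- by rewrite inE/= => -[X0 _]; rewrite mulr1 max_l// ltW.
- rewrite notin_setE/= mulr0 => /not_andP[/negP|].
    by rewrite -leNgt => X0; rewrite max_r.
  move=> Xx; rewrite max_r// leNgt; apply/negP => X0; apply: Xx.
  by move: tx; rewrite /= max_l// ltW.
- rewrite inE/= => -[X0 Xx]; exfalso; apply: tx.
  by rewrite max_l// ltW.
- by rewrite mulr0.
Qed.

Lemma G_neg (x : \bar R) : x <= 0 -> G X x = Fn (- x).
Proof.
move=> x0.
have [x00|x00] := eqVneq x 0.
  rewrite x00 oppe0 G_pos// /dist_fun; congr fine; rewrite /= /density_measure.
  rewrite !integral0_eq// => t /=; rewrite lee_fin => tx; congr EFin; apply/eqP.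
    by rewrite eq_le tx neg_part_ge0.
  by rewrite eq_le tx pos_part_ge0.
have {}x0 : x < 0 by rewrite lt_neqAle x00.
rewrite /G leNgt x0 /= /dist_fun; congr fine.
rewrite unlock /= /density_measure [RHS]integral_mkcond.
apply: eq_integral => t _; rewrite patchE /funrneg indicE.
case: ifPn; rewrite ?inE ?notin_setE /= => tx;
  case: (boolP (t \in [set w | x <= (X w)%:E /\ (X w < 0)%R])) => /=.
- by rewrite inE/= => -[_ X0]; rewrite mulr1 max_l// oppr_ge0 ltW.
- rewrite notin_setE/= mulr0 => /not_andP[|/negP]; last first.
    by rewrite -leNgt => X0; rewrite max_r// oppr_le0.
  move=> Xx; rewrite max_r// oppr_le0 leNgt; apply/negP => X0; apply: Xx.
  by move: tx; rewrite /= max_l ?oppr_ge0 ?(ltW X0)// EFinN leeN2.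
- rewrite inE/= => -[Xx X0]; exfalso; apply: tx.
  by rewrite max_l ?oppr_ge0 ?(ltW X0)// EFinN leeN2.
- by rewrite mulr0.
Qed.

Lemma x_plusE h : x_plus X h = Qp h.
Proof.
rewrite /x_plus /quantile; congr ereal_inf; apply/seteqP.
by split=> x /= [x0]; rewrite G_pos.
Qed.

Lemma x_minusE h : x_minus X h = - Qn h.
Proof.
rewrite /x_minus /quantile -ereal_supN; congr ereal_sup; apply/seteqP.
split=> x /= [].
  move=> x0; rewrite G_neg// => hx; exists (- x); last exact: oppeK.
  by rewrite oppe_ge0.
move=> y [y0 hy] <-; split; first by rewrite oppe_le0.
  by rewrite G_neg ?oppe_le0// oppeK.
Qed.

Lemma G_leftE (x : R) : (0 < x)%R -> G_left X x = Fp' x.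
Proof.
move=> x0; apply/cvg_lim => //; apply/cvgrPdist_lt => e e0.
have [y yx Fy] := @lt_dist_fun_left _ _ _ _ _ pos_fin measurable_pos_part
  (Fp' x - e)%R x ltac:(by rewrite ltrBlDr ltrDl).
near=> z.
have zx : (z < x)%R by near: z; exact: nbhs_left_lt.
have yz : (y < z)%R by near: z; exact: nbhs_left_gt.
have z0 : (0 < z)%R by near: z; exact: nbhs_left_gt.
rewrite G_pos ?lee_fin 1?ltW//.
have F1 : (Fp y%:E <= Fp z%:E)%R.
  by apply: (dist_fun_homo pos_fin measurable_pos_part); rewrite lee_fin ltW.
have F2 : (Fp z%:E <= Fp' x)%R.
  exact: (dist_fun_le_left pos_fin measurable_pos_part).
by rewrite ger0_norm ?subr_ge0//; lra.
Unshelve. all: by end_near. Qed.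

Lemma G_rightE (x : R) : (x < 0)%R -> G_right X x = Fn' (- x).
Proof.
move=> x0; apply/cvg_lim => //; apply/cvgrPdist_lt => e e0.
have [y yx Fy] := @lt_dist_fun_left _ _ _ _ _ neg_fin measurable_neg_part
  (Fn' (- x) - e)%R (- x)%R ltac:(by rewrite ltrBlDr ltrDl).
near=> z.
have zx : (x < z)%R by near: z; exact: nbhs_right_gt.
have yz : (z < - y)%R by near: z; apply: nbhs_right_lt; rewrite ltrNr.
have z0 : (z < 0)%R by near: z; exact: nbhs_right_lt.
rewrite G_neg ?lee_fin 1?ltW//.
have F1 : (Fn y%:E <= Fn (- z%:E))%R.
  apply: (dist_fun_homo neg_fin measurable_neg_part).
  by rewrite lee_fin lerNr ltW.
have F2 : (Fn (- z%:E) <= Fn' (- x))%R.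
  apply: (dist_fun_le_left neg_fin measurable_neg_part).
  by rewrite ltrN2.
by rewrite ger0_norm ?subr_ge0//; lra.
Unshelve. all: by end_near. Qed.

Lemma H_pos x u : (0 < x)%R -> H X x u = randomized_rank pos_measure xp x u.
Proof. by move=> x0; rewrite /H ltW// G_leftE// G_pos// lee_fin ltW. Qed.

Lemma H_neg x u : (x < 0)%R -> H X x u = randomized_rank neg_measure xn (- x) u.
Proof.
by move=> x0; rewrite /H leNgt x0 /= G_rightE// G_neg// lee_fin ltW.
Qed.

(** Where [X] has no atom the distribution function has no jump, and the rank
    does not depend on its second argument. *)
Lemma randomized_rank_pos (U : {RV P >-> R}) w : (0 < X w)%R ->
  randomized_rank pos_measure xp (X w) (randomization X U w) =
  randomized_rank pos_measure xp (X w) (U w).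
Proof.
move=> X0; rewrite /randomization; case: ifPn => // /negPn/eqP PX.
rewrite /randomized_rank (dist_fun_jump pos_fin measurable_pos_part).
suff -> : pos_measure [set t | xp t = X w] = 0 by rewrite !mulr0.
apply: density_null; first exact/measurable_sub_eq/measurable_pos_part.
rewrite -[RHS]PX; congr (P _); apply/seteqP; split => t /=; rewrite /funrpos.
  by case: leP => // _ X00; rewrite -X00 ltxx in X0.
by move=> ->; rewrite max_l// ltW.
Qed.

Lemma randomized_rank_neg (U : {RV P >-> R}) w : (X w < 0)%R ->
  randomized_rank neg_measure xn (- X w) (randomization X U w) =
  randomized_rank neg_measure xn (- X w) (U w).
Proof.
move=> X0; rewrite /randomization; case: ifPn => // /negPn/eqP PX.
rewrite /randomized_rank (dist_fun_jump neg_fin measurable_neg_part).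
suff -> : neg_measure [set t | xn t = (- X w)%R] = 0 by rewrite !mulr0.
apply: density_null; first exact/measurable_sub_eq/measurable_neg_part.
rewrite -[RHS]PX; congr (P _); apply/seteqP; split => t /=; rewrite /funrneg.
  case: leP => [_ X00|_ /oppr_inj//]; move: X0.
  by rewrite -oppr_gt0 -X00 ltxx.
by move=> ->; rewrite max_l// oppr_ge0 ltW.
Qed.

(** At most one of the two terms is nonzero, according to the sign of [X]; where
    [X] vanishes both do, whatever the reciprocating value. *)
Lemma abs_prod_recipE (U : {RV P >-> R}) w :
  abs_prod_recip X U w =
  (xp w)%:E * Qn (randomized_rank pos_measure xp (xp w) (U w)) +
  (xn w)%:E * Qp (randomized_rank neg_measure xn (xn w) (U w)).
Proof.
rewrite /abs_prod_recip /reciprocating /funrpos /funrneg.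
have [X0|X0|->] := ltgtP (X w) 0%R.
- rewrite H_neg// randomized_rank_neg// x_plusE.
  rewrite max_l ?oppr_ge0 ?(ltW X0)// mul0e add0e abseM.
  by rewrite (gee0_abs (quantile_ge0 _ _ _)) /= ltr0_norm.
- rewrite H_pos// randomized_rank_pos// x_minusE.
  rewrite max_r ?oppr_le0 ?(ltW X0)// mul0e adde0 abseM abseN.
  by rewrite (gee0_abs (quantile_ge0 _ _ _)) /= gtr0_norm.
- by rewrite oppr0 maxxx !mul0e abse0 adde0.
Qed.

End reciprocating_quantile.

(** * Disintegration into centered two-point laws *)

Section disintegration.
Context d (T : measurableType d) (R : realType) (P : probability T R).
Variables X U : {RV P >-> R}.
Hypotheses (X_mean : zero_mean X) (U_unif : uniform01 U).
Hypothesis XU : forall A B : set R, measurable A -> measurable B ->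
  P ((X @^-1` A) `&` (U @^-1` B)) = P (X @^-1` A) * P (U @^-1` B).

Local Notation xp := (X^\+%R).
Local Notation xn := (X^\-%R).
Local Notation mup := (pos_measure X).
Local Notation mun := (neg_measure X).
Local Notation Qp := (quantile mup xp).
Local Notation Qn := (quantile mun xn).
Local Notation mass := (fine (mup setT)).

Let X_int : P.-integrable setT (EFin \o X). Proof. by case: X_mean. Qed.

Let mup_fin : mup setT < +oo.
Proof. exact: density_fin (integrable_pos_part X_int). Qed.

Let mun_fin : mun setT < +oo.
Proof. exact: density_fin (integrable_neg_part X_int). Qed.

Let mxp := measurable_pos_part X.
Let mxn := measurable_neg_part X.

Lemma pos_neg_mass : mup setT = mun setT.
Proof.
have [_] := X_mean; rewrite unlock => EX.
have : \int[P]_w ((xp w)%:E - (xn w)%:E) = 0.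
  rewrite -[RHS]EX; apply: eq_integral => w _; rewrite -EFinB; congr EFin.
  rewrite /funrpos /funrneg; have [X0|X0] := leP 0%R (X w).
    by rewrite [X in (_ - X)%R]max_r ?oppr_le0// subr0.
  by rewrite max_l ?oppr_ge0 ?(ltW X0)// opprK add0r.
rewrite integralB_EFin//; [|exact: integrable_pos_part|exact: integrable_neg_part].
move/eqP; rewrite sube_eq ?add0e//; first by move/eqP.
exact: (integrable_fin_num measurableT (integrable_pos_part X_int)).
Qed.

Let xpU (x u : R) : P ([set t | xp t = x] `&` [set t | (U t < u)%R]) =
  P [set t | xp t = x] * P [set t | (U t < u)%R].
Proof.
rewrite (_ : [set t | xp t = x] =
    X @^-1` ((fun y => Num.max y 0%R) @^-1` [set x]))//.
rewrite (_ : [set t | (U t < u)%R] = U @^-1` `]-oo, u[); last first.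
  by apply/seteqP; split => t /=; rewrite in_itv.
apply: XU => //; rewrite -[X in measurable X]setTI.
by apply: measurable_maxr.
Qed.

Let xnU (x u : R) : P ([set t | xn t = x] `&` [set t | (U t < u)%R]) =
  P [set t | xn t = x] * P [set t | (U t < u)%R].
Proof.
rewrite (_ : [set t | xn t = x] =
    X @^-1` ((fun y : R => Num.max (- y) 0)%R @^-1` [set x]))//.
rewrite (_ : [set t | (U t < u)%R] = U @^-1` `]-oo, u[); last first.
  by apply/seteqP; split => t /=; rewrite in_itv.
apply: XU => //; rewrite -[X in measurable X]setTI.
by apply: measurable_maxr => //; exact: measurable_funN.
Qed.

Let Wp w := randomized_rank mup xp (xp w) (U w).
Let Wn w := randomized_rank mun xn (xn w) (U w).

Let mWp : measurable_fun setT Wp.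
Proof. exact: measurable_rank mup_fin mxp (measurable_funPT U). Qed.

Let mWn : measurable_fun setT Wn.
Proof. exact: measurable_rank mun_fin mxn (measurable_funPT U). Qed.

Let mQp : measurable_fun setT Qp.
Proof. exact: measurable_quantile. Qed.

Let mQn : measurable_fun setT Qn.
Proof. exact: measurable_quantile. Qed.

(** Independence is a statement about the pairs [(X_i, U_i)], so that [Y] has to
    be exhibited as a Borel function of such a pair. *)
Lemma abs_prod_recip_borel : exists2 y : R * R -> \bar R,
  measurable_fun setT y & forall w, abs_prod_recip X U w = y (X w, U w).
Proof.
exists (fun p => let a := Num.max p.1 0%R in let b := Num.max (- p.1)%R 0%R in
  a%:E * Qn (randomized_rank mup xp a p.2) +
  b%:E * Qp (randomized_rank mun xn b p.2)); last first.
  by move=> w; rewrite (abs_prod_recipE X_int).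
have ma : measurable_fun setT (fun p : R * R => Num.max p.1 0%R).
  exact: measurable_maxr.
have mb : measurable_fun setT (fun p : R * R => Num.max (- p.1)%R 0%R).
  by apply: measurable_maxr => //; exact: measurable_funN.
apply: emeasurable_funD; apply: emeasurable_funM; try exact/measurable_EFinP.
  apply: (measurableT_comp mQn).
  apply: (measurableT_comp (measurable_randomized_rank mup_fin mxp)
    (g := fun p : R * R => (Num.max p.1 0%R, p.2))).
  exact: measurable_fun_pair.
apply: (measurableT_comp mQp).
apply: (measurableT_comp (measurable_randomized_rank mun_fin mxn)
  (g := fun p : R * R => (Num.max (- p.1)%R 0%R, p.2))).
exact: measurable_fun_pair.
Qed.

(** On [X > 0] write [phi = X * (phi / X)] to see the expectation as an integral
    of [phi / X] against [X dP], and pass to the levels [h] by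
    [integral_quantile]; the part [X < 0] is symmetric. Both integrals run over
    the same interval of levels because [E X^+ = E X^-]. The inverse is written
    as the power [-1], which is a Borel function on the whole line. *)
Lemma disintegration (phi : R * \bar R -> \bar R) :
  measurable_fun setT phi -> (forall p, 0 <= phi p) ->
  \int[P]_w phi (X w, abs_prod_recip X U w) =
  phi (0%R, 0) * P [set w | X w = 0%R] +
  \int[lebesgue_measure]_(h in `]0%R, mass[)
    (phi (fine (Qp h), Qp h * Qn h) * ((fine (Qp h)) `^ (-1))%:E +
     phi ((- fine (Qn h))%R, Qp h * Qn h) * ((fine (Qn h)) `^ (-1))%:E).
Proof.
move=> mphi phi0.
pose gp h x := phi (fine x, x * Qn h) * ((fine x) `^ (-1))%:E.
pose gn h x := phi ((- fine x)%R, Qp h * x) * ((fine x) `^ (-1))%:E.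
have gp0 h x : 0 <= gp h x by rewrite mule_ge0// lee_fin powR_ge0.
have gn0 h x : 0 <= gn h x by rewrite mule_ge0// lee_fin powR_ge0.
have mf : measurable_fun setT (fun p : R * \bar R => fine p.2).
  by apply: (measurableT_comp (fine_measurable measurableT)); exact: measurable_snd.
have mgp : measurable_fun setT (fun p : R * \bar R => gp p.1 p.2).
  apply: emeasurable_funM.
    apply: (measurableT_comp mphi); apply: measurable_fun_pair => //.
    by apply: emeasurable_funM => //; exact: (measurableT_comp mQn).
  by apply/measurable_EFinP; apply: (measurableT_comp (measurable_powR _)).
have mgn : measurable_fun setT (fun p : R * \bar R => gn p.1 p.2).
  apply: emeasurable_funM.
    apply: (measurableT_comp mphi); apply: measurable_fun_pair => //.
      exact: measurable_funN.
    by apply: emeasurable_funM => //; exact: (measurableT_comp mQp).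
  by apply/measurable_EFinP; apply: (measurableT_comp (measurable_powR _)).
have mX0 : measurable [set w | X w = 0%R] by exact: measurable_sub_eq.
have mgpW : measurable_fun setT (fun w => gp (Wp w) (xp w)%:E).
  apply: (measurableT_comp mgp (g := fun t => (Wp t, (xp t)%:E))).
  by apply: measurable_fun_pair => //; exact/measurable_EFinP.
have mgnW : measurable_fun setT (fun w => gn (Wn w) (xn w)%:E).
  apply: (measurableT_comp mgn (g := fun t => (Wn t, (xn t)%:E))).
  by apply: measurable_fun_pair => //; exact/measurable_EFinP.
have mxgp : measurable_fun setT (fun w => (xp w)%:E * gp (Wp w) (xp w)%:E).
  by apply: emeasurable_funM => //; exact/measurable_EFinP.
have mxgn : measurable_fun setT (fun w => (xn w)%:E * gn (Wn w) (xn w)%:E).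
  by apply: emeasurable_funM => //; exact/measurable_EFinP.
transitivity (\int[P]_w (phi (0%R, 0) * (\1_[set w | X w = 0%R] w)%:E +
    ((xp w)%:E * gp (Wp w) (xp w)%:E + (xn w)%:E * gn (Wn w) (xn w)%:E))).
  apply: eq_integral => w _; rewrite (abs_prod_recipE X_int) indicE.
  have e0 : (w \in [set w | X w = 0%R]) = (X w == 0%R).
    by apply/idP/eqP; rewrite inE.
  rewrite e0 /gp /gn -/(Wp w) -/(Wn w) /funrpos /funrneg.
  have [X0|X0|->] := ltgtP (X w) 0%R.
  - rewrite max_l ?oppr_ge0 ?(ltW X0)//= !mul0e mule0 !add0e opprK muleCA.
    rewrite -EFinM powR_inv1 ?oppr_ge0 ?(ltW X0)// mulfV ?oppr_eq0 ?lt_eqF//.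
    by rewrite mule1 muleC.
  - rewrite max_r ?oppr_le0 ?(ltW X0)//= !mul0e mule0 !adde0 add0e muleCA.
    by rewrite -EFinM powR_inv1 ?(ltW X0)// mulfV ?mule1 ?gt_eqF.
  - by rewrite oppr0 maxxx !mul0e !adde0 mule1.
rewrite ge0_integralD//; last 4 first.
- by move=> w _; rewrite mule_ge0// lee_fin.
- by apply: measurable_funeM; exact/measurable_EFinP/measurable_indic.
- by move=> w _; rewrite adde_ge0// mule_ge0// lee_fin ?pos_part_ge0 ?neg_part_ge0.
- exact: emeasurable_funD.
congr (_ + _).
  rewrite ge0_integralZl//; last exact/measurable_EFinP/measurable_indic.
  by rewrite integral_indic// setIT.
rewrite ge0_integralD//; last 2 first.
- by move=> w _; rewrite mule_ge0// lee_fin pos_part_ge0.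
- by move=> w _; rewrite mule_ge0// lee_fin neg_part_ge0.
rewrite -(integral_density P (measurable_pos_part X) (pos_part_ge0 X))//.
rewrite -(integral_density P (measurable_neg_part X) (neg_part_ge0 X))//.
rewrite (integral_quantile mup_fin mxp (measurable_funPT U)
  (density_le0 _ _ _) (density_U01 _ _ U_unif) (density_atom _ _ U_unif xpU) mgp gp0).
rewrite (integral_quantile mun_fin mxn (measurable_funPT U)
  (density_le0 _ _ _) (density_U01 _ _ U_unif) (density_atom _ _ U_unif xnU) mgn gn0).
rewrite -pos_neg_mass -ge0_integralD//.
- apply: measurable_funTS; apply: (measurableT_comp mgp (g := fun h => (h, Qp h))).
  exact: measurable_fun_pair.
- apply: measurable_funTS; apply: (measurableT_comp mgn (g := fun h => (h, Qn h))).
  exact: measurable_fun_pair.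
Qed.

Lemma measurable_disintegration (phi : R * \bar R -> \bar R) :
  measurable_fun setT phi ->
  measurable_fun setT (fun h =>
    phi (fine (Qp h), Qp h * Qn h) * ((fine (Qp h)) `^ (-1))%:E +
    phi ((- fine (Qn h))%R, Qp h * Qn h) * ((fine (Qn h)) `^ (-1))%:E).
Proof.
move=> mphi.
have mfp : measurable_fun setT (fun h => fine (Qp h)).
  exact: (measurableT_comp (fine_measurable measurableT) mQp).
have mfn : measurable_fun setT (fun h => fine (Qn h)).
  exact: (measurableT_comp (fine_measurable measurableT) mQn).
apply: emeasurable_funD; apply: emeasurable_funM.
- apply: (measurableT_comp mphi); apply: measurable_fun_pair => //.
  exact: emeasurable_funM.
- by apply/measurable_EFinP; apply: (measurableT_comp (measurable_powR _)).
- apply: (measurableT_comp mphi); apply: measurable_fun_pair.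
    exact: measurable_funN.
  exact: emeasurable_funM.
- by apply/measurable_EFinP; apply: (measurableT_comp (measurable_powR _)).
Qed.

(** The integrand of [disintegration] is [1/a + 1/b] times the expectation under
    the centered law on [a] and [- b]. These weights and the mass of [X = 0] add
    up to 1, as [disintegration] applied to the constant 1 shows. *)
Lemma two_point_bound (phi : R * \bar R -> \bar R) (M : \bar R) :
  measurable_fun setT phi -> (forall p, 0 <= phi p) ->
  phi (0%R, 0) <= M ->
  (forall a b : R, (0 < a)%R -> (0 < b)%R ->
    (b / (a + b))%:E * phi (a, (a * b)%:E) +
    (a / (a + b))%:E * phi ((- b)%R, (a * b)%:E) <= M) ->
  \int[P]_w phi (X w, abs_prod_recip X U w) <= M.
Proof.
move=> mphi phi0 phiM0 phiM; case: M => [r| |] in phiM0 phiM *; first last.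
- by move: (le_trans (phi0 _) phiM0).
- by rewrite leey.
have r0 : 0 <= r%:E by exact: le_trans phiM0.
have mc1 : measurable_fun setT (cst 1 : R * \bar R -> \bar R) by [].
have mX0 : measurable [set w | X w = 0%R] by exact: measurable_sub_eq.
have mD : measurable (`]0%R, mass[ : set (measurableTypeR R)) by exact: measurable_itv.
have -> : r%:E = r%:E *
    \int[P]_w (cst 1 : R * \bar R -> \bar R) (X w, abs_prod_recip X U w).
  rewrite [X in _ * X](_ : _ = 1) ?mule1//.
  rewrite [LHS](@integral_cst _ _ _ P)// mul1e; exact: probability_setT.
rewrite !disintegration// mul1e ge0_muleDr//; last first.
  by apply: integral_ge0 => h _; rewrite adde_ge0// mule_ge0// lee_fin powR_ge0.
apply: leeD; first by rewrite lee_wpmul2r.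
rewrite -ge0_integralZl//; last 2 first.
- exact: (measurable_funTS (measurable_disintegration mc1)).
- by move=> h _; rewrite adde_ge0// mule_ge0// lee_fin powR_ge0.
apply: ge0_le_integral => //.
- by move=> h _; rewrite adde_ge0// mule_ge0// lee_fin powR_ge0.
- exact: (measurable_funTS (measurable_disintegration mphi)).
- apply: measurable_funeM.
  exact: (measurable_funTS (measurable_disintegration mc1)).
move=> h; rewrite /= in_itv/= => hm.
have [a -> [a0 _ _ _]] := quantile_spec mup_fin mxp (density_le0 _ _ _) hm.
have hm' : (0 < h < fine (mun setT))%R by rewrite -pos_neg_mass.
have [b -> [b0 _ _ _]] := quantile_spec mun_fin mxn (density_le0 _ _ _) hm'.
rewrite /= !powR_inv1 ?(ltW a0) ?(ltW b0)// !mul1e -EFinM.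
have ab0 : (0 < a + b)%R by rewrite addr_gt0.
have := phiM a b a0 b0.
set u := phi _; set v := phi _ => uv.
have -> : r%:E * (a^-1%:E + b^-1%:E) = ((a + b) / (a * b))%:E * r%:E.
  rewrite -EFinD -!EFinM; congr EFin; field.
  by rewrite ?gt_eqF.
have -> : u * a^-1%:E + v * b^-1%:E =
    ((a + b) / (a * b))%:E * ((b / (a + b))%:E * u + (a / (a + b))%:E * v).
  rewrite ge0_muleDr ?mule_ge0 ?phi0// ?lee_fin ?divr_ge0
    ?(ltW a0) ?(ltW b0) ?(ltW ab0)//.
  rewrite !muleA -!EFinM ![_ * u]muleC ![_ * v]muleC.
  congr (_ * _%:E + _ * _%:E); field; by rewrite ?gt_eqF.
by rewrite lee_wpmul2l// lee_fin divr_ge0 ?mulr_ge0 ?(ltW a0) ?(ltW b0) ?(ltW ab0).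
Qed.

End disintegration.

(** * Independent blocks of coordinates *)

Section independent_classes.
Context d (T : measurableType d) (R : realType) (P : probability T R).

Definition independent_classes (G1 G2 : set (set T)) :=
  forall A B, G1 A -> G2 B -> P (A `&` B) = P A * P B.

Lemma independent_classes_sym G1 G2 :
  independent_classes G1 G2 -> independent_classes G2 G1.
Proof. by move=> G12 A B GA GB; rewrite setIC G12// muleC. Qed.

Lemma independent_g_sigma_l (G1 G2 : set (set T)) :
  G1 `<=` measurable -> G2 `<=` measurable -> setI_closed G1 -> G1 setT ->
  independent_classes G1 G2 -> independent_classes <<s G1 >> G2.
Proof.
move=> mG1 mG2 G1I G1T G12 A B sA GB; have mB := mG2 _ GB.
have PB : P B = (fine (P B))%:E by rewrite fineK ?fin_num_measure.
rewrite PB muleC.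
apply: (@g_sigma_algebra_measure_unique _ R T G1 mG1 (fun=> setT) (fun=> G1T) _
  (mrestr P mB) (mscale (NngNum (fine_ge0 (measure_ge0 P B))) P) G1I _ _ A sA).
- by rewrite bigcup_const//; exists 0%N.
- move=> C GC; apply: (etrans (G12 C B GC GB)).
  by rewrite PB muleC.
- move=> _; rewrite (@le_lt_trans _ _ 1) ?ltry//; apply: probability_le1.
  exact: measurableI.
Qed.

(** Uniqueness of measures on a pi-system, applied on one side and then on the
    other. *)
Lemma independent_g_sigma (G1 G2 : set (set T)) :
  G1 `<=` measurable -> G2 `<=` measurable ->
  setI_closed G1 -> G1 setT -> setI_closed G2 -> G2 setT ->
  independent_classes G1 G2 -> independent_classes <<s G1 >> <<s G2 >>.
Proof.
move=> mG1 mG2 G1I G1T G2I G2T /(independent_g_sigma_l mG1 mG2 G1I G1T).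
move=> /independent_classes_sym G12; apply/independent_classes_sym.
apply: independent_g_sigma_l => //.
exact: (smallest_sub (@sigma_algebra_measurable _ T) mG1).
Qed.

End independent_classes.

Section independent_pair.
Context d d1 d2 (T : measurableType d) (S1 : measurableType d1)
  (S2 : measurableType d2) (R : realType) (P : probability T R).
Variables (V : T -> S1) (W : T -> S2).
Hypotheses (mV : measurable_fun setT V) (mW : measurable_fun setT W).
Hypothesis VW : forall A B, measurable A -> measurable B ->
  P ((V @^-1` A) `&` (W @^-1` B)) = P (V @^-1` A) * P (W @^-1` B).

(** Independence says that the law of the pair is the product of the laws on
    rectangles, hence everywhere, and Tonelli's theorem applies. *)
Lemma integral_independent_pair (psi : S1 * S2 -> \bar R) :
  measurable_fun setT psi -> (forall p, 0 <= psi p) ->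
  \int[P]_w psi (V w, W w) = \int[P]_w \int[P]_w' psi (V w, W w').
Proof.
move=> mpsi psi0.
pose V' : {mfun T >-> S1} := HB.pack V (isMeasurableFun.Build _ _ _ _ _ mV).
pose W' : {mfun T >-> S2} := HB.pack W (isMeasurableFun.Build _ _ _ _ _ mW).
have mVW : measurable_fun setT (fun w => (V w, W w)) by exact: measurable_fun_pair.
pose VW' : {mfun T >-> (S1 * S2)%type} :=
  HB.pack (fun w => (V w, W w)) (isMeasurableFun.Build _ _ _ _ _ mVW).
rewrite -[LHS](@ge0_integral_distribution _ _ _ _ _ P VW')//.
transitivity (\int[distribution P V' \x distribution P W']_p psi p).
  apply: eq_measure_integral => A mA _.
  apply/esym/(product_measure_unique (m' := distribution P VW')) => //.
rewrite fubini_tonelli1//.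
have mF : measurable_fun setT (fubini_F (distribution P W') psi).
  exact: measurable_fun_fubini_tonelli_F.
rewrite (@ge0_integral_distribution _ _ _ _ _ P V')//; last first.
  by move=> y; exact: integral_ge0.
apply: eq_integral => w _ /=; rewrite /fubini_F.
rewrite (@ge0_integral_distribution _ _ _ _ _ P W' (fun y => psi (V w, y)))//.
by apply: measurableT_comp => //; exact: measurable_fun_pair.
Qed.

End independent_pair.

Section blocks.
Context d (T : measurableType d) (R : realType) (P : probability T R).
Context (n : nat) (X U : 'I_n -> {RV P >-> R}).
Hypotheses (X_indep : independent_RVs X) (U_indep : independent_RVs U).
Hypothesis XU_indep : independent_families X U.

(** The cylinders over the pairs [(X_j, U_j)], [j] in [J]: they form a pi-system
    on which probabilities are explicit products. *)
Definition block (J : {set 'I_n}) (A C : 'I_n -> set R) : set T :=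
  \bigcap_(j in [set` J]) (X j @^-1` A j) `&`
  \bigcap_(j in [set` J]) (U j @^-1` C j).

Definition block_system (J : {set 'I_n}) : set (set T) :=
  [set B | exists A C, [/\ forall j, measurable (A j),
     forall j, measurable (C j) & B = block J A C]].

Let preimage_measurable (X0 : {RV P >-> R}) A : measurable A -> measurable (X0 @^-1` A).
Proof. by move=> mA; rewrite -[X in measurable X]setTI; exact: measurable_funPT. Qed.

Let measurable_cap (V : 'I_n -> {RV P >-> R}) (J : {set 'I_n}) A :
  (forall j, measurable (A j)) ->
  measurable (\bigcap_(j in [set` J]) (V j @^-1` A j)).
Proof.
by move=> mA; apply: fin_bigcap_measurable => // j _; exact: preimage_measurable.
Qed.

Lemma block_system_measurable J : block_system J `<=` measurable.
Proof.
by move=> _ [A [C [mA mC ->]]]; apply: measurableI; exact: measurable_cap.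
Qed.

Lemma block_systemT J : block_system J setT.
Proof.
exists (fun=> setT), (fun=> setT); split => //.
apply/seteqP; split=> // w _; split => j _ //.
Qed.

Lemma block_system_setI J : setI_closed (block_system J).
Proof.
move=> _ _ [A [C [mA mC ->]]] [A' [C' [mA' mC' ->]]].
exists (fun j => A j `&` A' j), (fun j => C j `&` C' j).
split; [by move=> j; exact: measurableI|by move=> j; exact: measurableI|].
apply/seteqP; split => [w [[wA wC] [wA' wC']]|w [wA wC]].
  by split => j Jj; split; [exact: wA|exact: wA'|exact: wC|exact: wC'].
split; split => j Jj.
- by have [] := wA j Jj.
- by have [] := wC j Jj.
- by have [] := wA j Jj.
- by have [] := wC j Jj.
Qed.

Let generated_cap (V : 'I_n -> {RV P >-> R}) (J : {set 'I_n}) A :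
  (forall j, measurable (A j)) ->
  generated_sigma V (\bigcap_(j in [set` J]) (V j @^-1` A j)).
Proof.
move=> mA; rewrite /generated_sigma; set G := \bigcup_(i in [set: 'I_n]) _.
apply: (@fin_bigcap_measurable _ (g_sigma_algebraType G)) => // j _.
apply: sub_sigma_algebra; exists j => //; exists (A j) => //.
by rewrite setTI.
Qed.

Lemma block_probability J A C :
  (forall j, measurable (A j)) -> (forall j, measurable (C j)) ->
  P (block J A C) =
  \prod_(j in J) (P (X j @^-1` A j) * P (U j @^-1` C j)).
Proof.
move=> mA mC; rewrite /block XU_indep; [|exact: generated_cap..].
by rewrite X_indep// U_indep// big_split.
Qed.

(** The intersection of cylinders over disjoint index sets is a cylinder over
    the union, whose probability splits. *)
Lemma independent_blocks (J K : {set 'I_n}) : [disjoint J & K]%B ->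
  independent_classes P <<s block_system J >> <<s block_system K >>.
Proof.
move=> JK; apply: independent_g_sigma.
- exact: block_system_measurable.
- exact: block_system_measurable.
- exact: block_system_setI.
- exact: block_systemT.
- exact: block_system_setI.
- exact: block_systemT.
move=> _ _ [A [C [mA mC ->]]] [A' [C' [mA' mC' ->]]].
pose A'' j := if j \in J then A j else A' j.
pose C'' j := if j \in J then C j else C' j.
have KJ j : j \in K -> (j \in J) = false.
  by move=> Kj; apply: (disjointFl JK).
have -> : block J A C `&` block K A' C' = block (J :|: K) A'' C''.
  apply/seteqP; split => [w [[wA wC] [wA' wC']]|w [wA wC]].
    split => j /=; rewrite inE /A'' /C'' => /orP[Jj|Kj].
    - by rewrite Jj; exact: wA.
    - by rewrite KJ//; exact: wA'.
    - by rewrite Jj; exact: wC.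
    - by rewrite KJ//; exact: wC'.
  split; split => j /= Jj.
  - by have := wA j; rewrite /= inE Jj /A'' Jj; exact.
  - by have := wC j; rewrite /= inE Jj /C'' Jj; exact.
  - by have := wA j; rewrite /= inE Jj orbT /A'' KJ//; exact.
  - by have := wC j; rewrite /= inE Jj orbT /C'' KJ//; exact.
rewrite !block_probability//; last 2 first.
- by move=> j; rewrite /A''; case: ifP.
- by move=> j; rewrite /C''; case: ifP.
rewrite (eq_bigl (fun j => (j \in J) || (j \in K))); last by move=> j; rewrite inE.
rewrite bigU//=; congr (_ * _); apply: eq_bigr => j.
  by rewrite /A'' /C'' => ->.
by rewrite /A'' /C'' => /KJ ->.
Qed.

Lemma measurable_block_X (J : {set 'I_n}) j : j \in J ->
  measurable_fun setT (X j : g_sigma_algebraType (block_system J) -> R).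
Proof.
move=> Jj _ A mA; rewrite setTI; apply: sub_sigma_algebra.
exists (fun i => if i == j then A else setT), (fun=> setT).
split => // [i|]; first by case: ifP.
apply/seteqP; split => [w wA|w [wA _]].
  by split => i //= _; case: eqP => // ->.
by have := wA j Jj; rewrite /= eqxx.
Qed.

Lemma measurable_block_U (J : {set 'I_n}) j : j \in J ->
  measurable_fun setT (U j : g_sigma_algebraType (block_system J) -> R).
Proof.
move=> Jj _ A mA; rewrite setTI; apply: sub_sigma_algebra.
exists (fun=> setT), (fun i => if i == j then A else setT).
split => // [i|]; first by case: ifP.
apply/seteqP; split => [w wA|w [_ wA]].
  by split => i //= _; case: eqP => // ->.
by have := wA j Jj; rewrite /= eqxx.
Qed.

End blocks.
(** * Peeling off one summand *)

Section tails.
Context d (T : measurableType d) (R : realType) (P : probability T R).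
Context (n : nat) (X U : 'I_n -> {RV P >-> R}).
Hypotheses (X_indep : independent_RVs X) (U_indep : independent_RVs U).
Hypothesis XU_indep : independent_families X U.
Hypotheses (X_mean : forall i, zero_mean (X i)).
Variable lambda : R.

Lemma independent_families_pair i (A B : set R) : measurable A -> measurable B ->
  P ((X i @^-1` A) `&` (U i @^-1` B)) = P (X i @^-1` A) * P (U i @^-1` B).
Proof.
move=> mA mB; apply: XU_indep; apply: sub_sigma_algebra; exists i => //.
  by exists A => //; rewrite setTI.
by exists B => //; rewrite setTI.
Qed.

Definition tail_sum (k : nat) (w : T) : R := (\sum_(j < n | (k <= j)%N) X j w)%R.

Definition tail_scale (k : nat) (w : T) : \bar R :=
  \sum_(j < n | (k <= j)%N) abs_prod_recip (X j) (U j) w `^ lambda.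

Let Y i w := abs_prod_recip (X i) (U i) w.

Let measurable_Y_block (J : {set 'I_n}) j : j \in J ->
  measurable_fun setT (Y j : g_sigma_algebraType (block_system X U J) -> \bar R).
Proof.
move=> Jj; have [y my yE] := @abs_prod_recip_borel _ _ _ _ (X j) (U j) (X_mean j).
rewrite (_ : Y j = y \o (fun w => (X j w, U j w))); last exact: funext.
apply: (measurableT_comp my); apply: measurable_fun_pair.
  exact: measurable_block_X.
exact: measurable_block_U.
Qed.

Let head_block (k : 'I_n) : {set 'I_n} := [set k]%SET.
Let tail_block (k : 'I_n) : {set 'I_n} := [set j : 'I_n | (k < j)%N]%SET.

Let measurable_head (k : 'I_n) : measurable_fun setT
  ((fun w => (X k w, Y k w)) :
    g_sigma_algebraType (block_system X U (head_block k)) -> (R * \bar R)%type).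
Proof.
have kk : k \in head_block k by rewrite inE.
apply: measurable_fun_pair; first exact: measurable_block_X.
exact: measurable_Y_block.
Qed.

Let measurable_tail (k : 'I_n) : measurable_fun setT
  ((fun w => (tail_sum k.+1 w, tail_scale k.+1 w)) :
    g_sigma_algebraType (block_system X U (tail_block k)) -> (R * \bar R)%type).
Proof.
have kj (j : 'I_n) : (k < j)%N -> j \in tail_block k by rewrite inE.
apply: measurable_fun_pair.
  rewrite [X in measurable_fun _ X](_ : _ =
    fun w => \sum_(j < n) if (k < j)%N then X j w else 0)%R; last first.
    by apply/funext => w; rewrite /tail_sum big_mkcond.
  apply: measurable_sum => j.
  case: (boolP (k < j)%N) => [/kj ?|_]; last exact: measurable_cst.
  exact: measurable_block_X.
rewrite [X in measurable_fun _ X](_ : _ =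
  fun w => \sum_(j < n) if (k < j)%N then Y j w `^ lambda else 0); last first.
  by apply/funext => w; rewrite /tail_scale big_mkcond.
apply: emeasurable_sum => j.
case: (boolP (k < j)%N) => [/kj ?|_]; last exact: measurable_cst.
by apply: (measurableT_comp (measurable_poweR _)); exact: measurable_Y_block.
Qed.

Let sub_block (J : {set 'I_n}) d' (S : measurableType d') (f : T -> S) :
  measurable_fun setT (f : g_sigma_algebraType (block_system X U J) -> S) ->
  measurable_fun setT f.
Proof.
move=> mf _ A mA; have := mf measurableT A mA.
apply: smallest_sub; first exact: sigma_algebra_measurable.
exact: block_system_measurable.
Qed.

Lemma measurable_tail_pair (k : 'I_n) :
  measurable_fun setT (fun w => (tail_sum k.+1 w, tail_scale k.+1 w)).
Proof. by apply: (@sub_block (tail_block k)); exact: measurable_tail. Qed.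

(** The pair [(X_k, Y_k)] depends on the block of [k] and the sums over the
    larger indices on a block disjoint from it. *)
Lemma integral_tail (k : 'I_n) (psi : R * \bar R -> \bar R) :
  measurable_fun setT psi -> (forall p, 0 <= psi p) ->
  \int[P]_w psi (tail_sum k w, tail_scale k w) =
  \int[P]_w \int[P]_w' psi ((X k w + tail_sum k.+1 w')%R,
    Y k w `^ lambda + tail_scale k.+1 w').
Proof.
move=> mpsi psi0.
pose add (p : (R * \bar R) * (R * \bar R)) :=
  ((p.1.1 + p.2.1)%R, p.1.2 `^ lambda + p.2.2).
have madd : measurable_fun setT add.
  have m11 : measurable_fun setT (fun p : (R * \bar R) * (R * \bar R) => p.1.1).
    by apply: (measurableT_comp measurable_fst); exact: measurable_fst.
  have m12 : measurable_fun setT (fun p : (R * \bar R) * (R * \bar R) => p.1.2).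
    by apply: (measurableT_comp measurable_snd); exact: measurable_fst.
  have m21 : measurable_fun setT (fun p : (R * \bar R) * (R * \bar R) => p.2.1).
    by apply: (measurableT_comp measurable_fst); exact: measurable_snd.
  have m22 : measurable_fun setT (fun p : (R * \bar R) * (R * \bar R) => p.2.2).
    by apply: (measurableT_comp measurable_snd); exact: measurable_snd.
  apply: measurable_fun_pair; first exact: measurable_funD.
  apply: emeasurable_funD => //; exact: (measurableT_comp (measurable_poweR _)).
rewrite -(integral_independent_pair (V := fun w => (X k w, Y k w))
  (W := fun w => (tail_sum k.+1 w, tail_scale k.+1 w)) _ _ _
  (psi := psi \o add))//.
- apply: eq_integral => w _ /=; congr psi; rewrite /add /= /tail_sum /tail_scale.
  rewrite (bigD1 k)//= [in X in _ = (_, X)]addeC [X in (_, X)](bigD1 k)//= addeC.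
  by congr (_ + _, _ + _)%R; apply: eq_bigl => j; rewrite ltn_neqAle andbC eq_sym.
- by apply: (@sub_block (head_block k)); exact: measurable_head.
- exact: measurable_tail_pair.
- move=> A B mA mB.
  apply: (independent_blocks X_indep U_indep XU_indep
    (J := head_block k) (K := tail_block k)).
  + by rewrite disjoints1 inE ltnn.
  + by rewrite -[X in <<s _ >> X]setTI; exact: (measurable_head measurableT).
  + by rewrite -[X in <<s _ >> X]setTI; exact: (measurable_tail measurableT).
- exact: measurableT_comp.
- by move=> p; exact: psi0.
Qed.

End tails.

(** * Adjoining a centered coin to a two-point family *)

Section two_point_families.
Context (R : realType).

(** The last clause identifies the degenerate members: it is what forces the sum
    to vanish when its scale does. *)
Definition two_point_family m d (T : measurableType d) (P : probability T R)
    (Z : 'I_m -> {RV P >-> R}) (c c' : 'I_m -> R) : Prop :=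
  [/\ independent_RVs Z, forall i, zero_mean (Z i),
      forall i, takes_two_values (Z i) (c i) (c' i) &
      forall i, (c i * c' i = 0 -> c i = 0 /\ c' i = 0)%R].

Section adjoin_coin.
Context (m : nat) d (T : measurableType d) (P : probability T R).
Variables (Z : 'I_m -> {RV P >-> R}) (c c' : 'I_m -> R).
Hypothesis Zcc : two_point_family Z c c'.
Variables p a b : R.
Hypotheses (p01 : (0 < p < 1)%R) (pab : (p * a + (1 - p) * b = 0)%R).

Let P' : probability (bool * T)%type R := bernoulli_prob p \x P.

Let coin_fun (x : bool * T) : R := if x.1 then a else b.

Let measurable_coin : measurable_fun setT coin_fun.
Proof.
exact: (measurableT_comp (f := fun y : bool => if y then a else b)).
Qed.

Let coin : {RV P' >-> R} :=
  HB.pack coin_fun (isMeasurableFun.Build _ _ _ _ _ measurable_coin).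

Let measurable_old j : measurable_fun setT (fun x : bool * T => Z j x.2).
Proof.
by apply: (measurableT_comp (measurable_funPT (Z j))); exact: measurable_snd.
Qed.

Let old j : {RV P' >-> R} :=
  HB.pack (fun x : bool * T => Z j x.2)
    (isMeasurableFun.Build _ _ _ _ _ (measurable_old j)).

Definition adjoin_coin (i : 'I_m.+1) : {RV P' >-> R} :=
  if unlift ord0 i is Some j then old j else coin.

Definition adjoin_value (x : R) (f : 'I_m -> R) (i : 'I_m.+1) : R :=
  if unlift ord0 i is Some j then f j else x.

Lemma adjoin_coin0 x : adjoin_coin ord0 x = coin_fun x.
Proof. by rewrite /adjoin_coin unlift_none. Qed.

Lemma adjoin_coinS j x : adjoin_coin (lift ord0 j) x = Z j x.2.
Proof. by rewrite /adjoin_coin liftK. Qed.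

Let P'X (A : set bool) (B : set T) : measurable B ->
  P' (A `*` B) = bernoulli_prob p A * P B.
Proof. by move=> mB; exact: product_measure1E. Qed.

Let P'snd (B : set T) : measurable B -> P' (snd @^-1` B) = P B.
Proof.
move=> mB; rewrite (_ : _ @^-1` _ = setT `*` B); last first.
  by apply/seteqP; split => x // [].
by rewrite P'X// probability_setT mul1e.
Qed.

Let P'fst (A : set bool) : P' (fst @^-1` A) = bernoulli_prob p A.
Proof.
rewrite (_ : _ @^-1` _ = A `*` setT); last first.
  by apply/seteqP; split => x // [].
by rewrite P'X// probability_setT mule1.
Qed.

Let p_ge0 : (0 <= p <= 1)%R. Proof. by case/andP: p01 => p0 p1; rewrite !ltW. Qed.

Lemma integral_adjoin (g : bool * T -> \bar R) :
  measurable_fun setT g -> (forall x, 0 <= g x) ->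
  \int[P']_x g x = \int[P]_w (p%:E * g (true, w) + (1 - p)%:E * g (false, w)).
Proof.
move=> mg g0; have [p0 p1] := andP p_ge0.
have mgb y : measurable_fun setT (fun w => g (y, w)).
  by apply: measurableT_comp => //; exact: measurable_fun_pair.
rewrite fubini_tonelli1// integral_bernoulli_prob//; last first.
  by move=> y; exact: integral_ge0.
rewrite /fubini_F ge0_integralD//.
- by rewrite !ge0_integralZl// ?lee_fin// subr_ge0.
- by move=> w _; rewrite mule_ge0// lee_fin.
- exact: measurable_funeM.
- by move=> w _; rewrite mule_ge0// lee_fin subr_ge0.
- exact: measurable_funeM.
Qed.

(** The coin depends on the first factor of the product space and the old
    variables on the second one, so events of the enlarged family are
    rectangles. *)
Lemma two_point_family_adjoin_coin : (a * b = 0 -> a = 0 /\ b = 0)%R ->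
  two_point_family adjoin_coin (adjoin_value a c) (adjoin_value b c').
Proof.
move=> ab0; have [Z_indep Z_mean Z_two Z_deg] := Zcc.
have [p0 p1] := andP p01.
have zmZ j : zero_mean (old j).
  have [Z_int] := Z_mean j; rewrite unlock => EZ.
  have mg : measurable_fun setT (fun x : bool * T => `|(Z j x.2)%:E|).
    by apply: measurableT_comp => //; exact/measurable_EFinP.
  have old_int : P'.-integrable setT (EFin \o old j).
    apply/integrableP; split; first exact/measurable_EFinP.
    rewrite (integral_adjoin mg)//.
    move/integrableP : Z_int => -[_]; congr (_ < _); apply: eq_integral => w _ /=.
    by rewrite -muleDl// -EFinD subrKC mul1e.
  split=> //; rewrite unlock -[RHS]EZ.
  transitivity (\int[pushforward P' snd]_y (Z j y)%:E).
    rewrite (@integral_pushforward _ _ _ _ _ snd measurable_snd)//.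
    exact/measurable_EFinP.
  by apply: eq_measure_integral => A mA _; exact: P'snd.
have zm0 : zero_mean coin.
  have mcoin : measurable_fun setT (EFin \o coin_fun) by exact/measurable_EFinP.
  have cstP (r : R) : \int[P]_w r%:E = r%:E.
    rewrite (@integral_cst _ _ _ P setT)// [X in _ * X](_ : _ = 1) ?mule1//.
    exact: probability_setT.
  split.
    apply/integrableP; split=> //.
    rewrite integral_adjoin//; last exact: measurableT_comp.
    exact: (eq_ind_r (fun z => z < +oo) (ltry _) (cstP (p * `|a| + (1 - p) * `|b|)%R)).
  (* Tonelli's formula needs nonnegative integrands: split coin by sign. *)
  rewrite unlock integralE.
  rewrite (_ : (fun w => (coin w)%:E)^\+ = fun x => (Num.max (coin_fun x) 0%R)%:E);
    last by apply/funext => x; rewrite funeposE EFin_max.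
  rewrite (_ : (fun w => (coin w)%:E)^\- = fun x => (Num.max (- coin_fun x)%R 0%R)%:E);
    last by apply/funext => x; rewrite funenegE EFin_max.
  rewrite integral_adjoin//; last 2 first.
  - by apply/measurable_EFinP; exact: measurable_maxr.
  - by move=> x; rewrite lee_fin le_max lexx orbT.
  rewrite integral_adjoin//; last 2 first.
  - by apply/measurable_EFinP; apply: measurable_maxr => //; exact: measurable_funN.
  - by move=> x; rewrite lee_fin le_max lexx orbT.
  apply: (etrans (f_equal2 (fun x y => x - y)
    (cstP (p * Num.max a 0 + (1 - p) * Num.max b 0)%R)
    (cstP (p * Num.max (- a) 0 + (1 - p) * Num.max (- b) 0)%R))).
  rewrite -EFinB; congr EFin.
  rewrite -[RHS]pab; have posneg (r : R) : (Num.max r 0 - Num.max (- r) 0 = r)%R.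
    have [r0|r0] := leP 0%R r; first by rewrite [X in (_ - X)%R]max_r ?oppr_le0// subr0.
    by rewrite max_l ?oppr_ge0 ?(ltW r0)// opprK add0r.
  by rewrite -{3}(posneg a) -{3}(posneg b); ring.
have tvZ j : takes_two_values (old j) (c j) (c' j).
  have [Zcc' Zc Zc'] := Z_two j; split.
  - by move=> x; exact: Zcc'.
  - rewrite [ltRHS](_ : _ = P (Z j @^-1` [set c j]))//; apply: P'snd.
    by rewrite -[X in measurable X]setTI; exact: measurable_funPT.
  - rewrite [ltRHS](_ : _ = P (Z j @^-1` [set c' j]))//; apply: P'snd.
    by rewrite -[X in measurable X]setTI; exact: measurable_funPT.
have mfst (y : bool) : measurable (fst @^-1` [set y] : set (bool * T)).
  by rewrite -[X in measurable X]setTI; exact: measurable_fst.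
have P'fst_gt0 (y : bool) : 0 < P' (fst @^-1` [set y]).
  rewrite P'fst bernoulli_probE// !diracE.
  case: y; rewrite ?(mem_set (erefl _ : [set _] _)) ?memNset//=
    ?mule0 ?mule1 ?adde0 ?add0e lte_fin//.
  by rewrite subr_gt0.
have tv0 : takes_two_values coin a b.
  split.
  - by move=> [[] x]; [left|right].
  - apply: (lt_le_trans (P'fst_gt0 true)); apply: le_measure.
    + by rewrite inE; exact: mfst.
    + by rewrite inE -[X in measurable X]setTI; exact: measurable_coin.
    + by move=> [[] x].
  - apply: (lt_le_trans (P'fst_gt0 false)); apply: le_measure.
    + by rewrite inE; exact: mfst.
    + by rewrite inE -[X in measurable X]setTI; exact: measurable_coin.
    + by move=> [[] x].
split.
- move=> J A mA.
  pose J' := [set j : 'I_m | lift ord0 j \in J]%SET.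
  pose A0 := if ord0 \in J then [set y : bool | A ord0 (if y then a else b)] else setT.
  have -> : \bigcap_(i in [set` J]) (adjoin_coin i @^-1` A i) =
      A0 `*` \bigcap_(j in [set` J']) (Z j @^-1` A (lift ord0 j)).
    apply/seteqP; split => [x xA|x [xA0 xA] i].
      split; rewrite /A0.
        case: ifPn => // J0; have := xA ord0 J0.
        by rewrite /= adjoin_coin0.
      move=> j /=; rewrite inE => Jj; have := xA _ Jj.
      by rewrite /= adjoin_coinS.
    rewrite /=; case: (unliftP ord0 i) => [j ->|->] Ji.
      by rewrite adjoin_coinS; apply: xA; rewrite /= inE.
    by move: xA0; rewrite /A0 Ji adjoin_coin0.
  rewrite P'X; last first.
    apply: fin_bigcap_measurable => // j _.
    by rewrite -[X in measurable X]setTI; exact: measurable_funPT.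
  rewrite Z_indep// [in RHS]big_mkcond big_ord_recl; congr (_ * _).
    rewrite /A0; case: ifPn => J0; last by rewrite probability_setT.
    rewrite -P'fst; congr (P' _); apply/seteqP.
    by split => x /=; rewrite adjoin_coin0.
  rewrite [in LHS]big_mkcond; apply: eq_bigr => j _; rewrite inE.
  case: ifPn => // _; rewrite -P'snd; last first.
    by rewrite -[X in measurable X]setTI; exact: measurable_funPT.
  congr (P' _); apply/seteqP.
  by split => x /=; rewrite adjoin_coinS.
- by move=> i; rewrite /adjoin_coin; case: unlift.
- by move=> i; rewrite /adjoin_coin /adjoin_value; case: unlift.
- by move=> i; rewrite /adjoin_value; case: unlift.
Qed.

End adjoin_coin.
End two_point_families.

(** * Replacing the summands one at a time *)

Section comparison.
Context d (T : measurableType d) (R : realType) (P : probability T R).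
Context (n : nat) (X U : 'I_n -> {RV P >-> R}).
Hypotheses (X_indep : independent_RVs X) (U_indep : independent_RVs U).
Hypothesis XU_indep : independent_families X U.
Hypotheses (X_mean : forall i, zero_mean (X i)).
Hypotheses (U_unif : forall i, uniform01 (U i)).
Variables (lambda : R) (M : \bar R).

(** Induction on the number [m] of summands left. The first one, [X_k], is
    replaced by a coin with values [a] and [b] by means of [two_point_bound];
    averaging [psi] over this coin gives a function [mix p a b] of the remaining
    sums, and the induction hypothesis applies to it because an integral of
    [mix p a b] over a two-point family is one of [psi] over the family with the
    coin adjoined. *)
Lemma tail_comparison (m k : nat) (psi : R * \bar R -> \bar R) : (k + m = n)%N ->
  measurable_fun setT psi -> (forall p, 0 <= psi p) ->
  (forall d' (T' : measurableType d') (P' : probability T' R)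
      (Z : 'I_m -> {RV P' >-> R}) (c c' : 'I_m -> R), two_point_family Z c c' ->
    \int[P']_w psi ((\sum_(i < m) Z i w)%R,
      (\sum_(i < m) `|c i * c' i| `^ lambda)%R%:E) <= M) ->
  \int[P]_w psi (tail_sum X k w, tail_scale X U lambda k w) <= M.
Proof.
elim: m k psi => [|m IH] k psi kmn mpsi psi0 psiM.
  have kn : k = n by rewrite -kmn addn0.
  apply: le_trans (psiM _ T P (fun i => X (cast_ord kn (widen_ord (leq0n k) i)))
    (fun=> 0%R) (fun=> 0%R) _); last first.
    split; try by case.
    move=> J A mA; rewrite big_pred0; last by case.
    rewrite (_ : \bigcap_(i in _) _ = setT) ?probability_setT//.
    by apply/seteqP; split => // w _ [].
  rewrite le_eqVlt; apply/orP; left; apply/eqP; apply: eq_integral => w _.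
  have kj (j : 'I_n) : (k <= j)%N = false by rewrite kn leqNgt ltn_ord.
  by rewrite /tail_sum /tail_scale !big_ord0 !big_pred0.
have kn : (k < n)%N by rewrite -kmn addnS ltnS leq_addr.
pose K := Ordinal kn.
have mtail := @measurable_tail_pair _ _ _ _ _ X U X_mean lambda K.
pose phi (p : R * \bar R) := \int[P]_w psi ((p.1 + tail_sum X k.+1 w)%R,
  p.2 `^ lambda + tail_scale X U lambda k.+1 w).
have mpsi_add (x : R) (y : \bar R) : measurable_fun setT
    (fun p : R * \bar R => psi ((x + p.1)%R, y + p.2)).
  apply: (measurableT_comp mpsi); apply: measurable_fun_pair.
    exact: measurable_funD.
  exact: emeasurable_funD.
pose mix (p a b : R) (q : R * \bar R) :=
  p%:E * psi ((a + q.1)%R, (`|a * b| `^ lambda)%:E + q.2) +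
  (1 - p)%:E * psi ((b + q.1)%R, (`|a * b| `^ lambda)%:E + q.2).
have mixM p a b : (0 < p < 1)%R -> (p * a + (1 - p) * b = 0)%R ->
    (a * b = 0 -> a = 0 /\ b = 0)%R ->
    \int[P]_w mix p a b (tail_sum X k.+1 w, tail_scale X U lambda k.+1 w) <= M.
  move=> p01 pab ab0; have [p0 p1] := andP p01.
  apply: IH.
  - by rewrite addSnnS.
  - by apply: emeasurable_funD; apply: measurable_funeM; exact: mpsi_add.
  - by move=> q; rewrite adde_ge0// mule_ge0// lee_fin ?subr_ge0 ltW.
  move=> d' T' P' Z c c' Zcc.
  have := psiM _ _ _ _ _ _ (two_point_family_adjoin_coin Zcc p01 pab ab0).
  rewrite integral_adjoin//; last first.
    apply: (measurableT_comp mpsi); apply: measurable_fun_pair => //.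
    exact: measurable_sum.
  congr (_ <= _); apply: eq_integral => w _.
  have EZ y : (\sum_(i < m.+1) adjoin_coin Z p a b i (y, w) =
      (if y then a else b) + \sum_(i < m) Z i w)%R.
    rewrite big_ord_recl adjoin_coin0; congr +%R.
    by apply: eq_bigr => i _; rewrite adjoin_coinS.
  have Ec : (\sum_(i < m.+1) `|adjoin_value a c i * adjoin_value b c' i| `^ lambda =
      `|a * b| `^ lambda + \sum_(i < m) `|c i * c' i| `^ lambda)%R.
    rewrite big_ord_recl /adjoin_value !unlift_none; congr +%R.
    by apply: eq_bigr => i _; rewrite liftK.
  by rewrite /mix /= !EZ Ec.
have phiE p a b : (0 < p < 1)%R ->
    p%:E * phi (a, `|a * b|%:E) + (1 - p)%:E * phi (b, `|a * b|%:E) =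
    \int[P]_w mix p a b (tail_sum X k.+1 w, tail_scale X U lambda k.+1 w).
  move=> /andP[p0 p1].
  have mt x y : measurable_fun setT (fun w => psi ((x + tail_sum X k.+1 w)%R,
      y + tail_scale X U lambda k.+1 w)).
    exact: (measurableT_comp (mpsi_add x y) mtail).
  rewrite /phi -!ge0_integralZl//=; [|by rewrite lee_fin ?subr_ge0 ltW..].
  rewrite -ge0_integralD//.
  - by move=> w _; rewrite mule_ge0// lee_fin ltW.
  - exact: measurable_funeM.
  - by move=> w _; rewrite mule_ge0// lee_fin subr_ge0 ltW.
  - exact: measurable_funeM.
have mphi : measurable_fun setT phi.
  pose g (q : (R * \bar R) * T) := psi ((q.1.1 + tail_sum X k.+1 q.2)%R,
    q.1.2 `^ lambda + tail_scale X U lambda k.+1 q.2).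
  suff mg : measurable_fun setT g.
    by apply: (measurable_fun_fubini_tonelli_F (m2 := P) g mg) => q; exact: psi0.
  apply: (measurableT_comp mpsi); apply: measurable_fun_pair.
    apply: measurable_funD.
      by apply: (measurableT_comp measurable_fst); exact: measurable_fst.
    apply: (measurableT_comp (f := fst \o (fun w =>
      (tail_sum X k.+1 w, tail_scale X U lambda k.+1 w)))).
      by apply: (measurableT_comp measurable_fst); exact: mtail.
    exact: measurable_snd.
  apply: emeasurable_funD.
    apply: (measurableT_comp (measurable_poweR _)).
    by apply: (measurableT_comp measurable_snd); exact: measurable_fst.
  apply: (measurableT_comp (f := snd \o (fun w =>
    (tail_sum X k.+1 w, tail_scale X U lambda k.+1 w)))).
    by apply: (measurableT_comp measurable_snd); exact: mtail.
  exact: measurable_snd.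
rewrite (integral_tail X_indep U_indep XU_indep X_mean lambda K mpsi psi0).
apply: (@two_point_bound _ _ _ _ (X K) (U K) (X_mean K) (U_unif K) _ phi).
- by move=> A B mA mB; exact: independent_families_pair.
- exact: mphi.
- by move=> p; exact: integral_ge0.
- (* The value at 0 is that of the coin whose two values are both 0. *)
  have h01 : (0 < (2^-1 : R) < 1)%R by apply/andP; split; lra.
  apply: (le_trans _ (mixM _ 0%R 0%R h01 _ _)); last 2 first.
  - by rewrite !mulr0 addr0.
  - by [].
  rewrite -phiE// mulr0 normr0 -ge0_muleDl ?lee_fin; [|lra|lra].
  by rewrite -EFinD subrKC mul1e.
- move=> a b a0 b0; have ab0 : (0 < a + b)%R by exact: addr_gt0.
  have p01 : (0 < b / (a + b) < 1)%R.
    by rewrite divr_gt0//= ltr_pdivrMr// mul1r ltrDr.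
  have -> : (a / (a + b) = 1 - b / (a + b))%R by field; rewrite gt_eqF.
  have -> : (a * b = `|a * - b|)%R.
    by rewrite mulrN normrN gtr0_norm// mulr_gt0.
  rewrite phiE//; apply: mixM => //.
    by field; rewrite gt_eqF.
  by move/eqP; rewrite mulf_eq0 oppr_eq0 !gt_eqF.
Qed.

End comparison.

(** * Normalizing a two-point family *)

Section rescaling.
Context (R : realType) (n : nat) (lambda : R) (f : R -> R).
Hypothesis lambda_gt0 : (0 < lambda)%R.
Context d (T : measurableType d) (P : probability T R).
Variables (Z : 'I_n -> {RV P >-> R}) (c c' : 'I_n -> R).
Hypothesis Zcc : two_point_family Z c c'.
Let t : R := (\sum_(i < n) `|c i * c' i| `^ lambda)%R.

Lemma two_point_family_eq0 : t = 0%R -> forall i w, Z i w = 0%R.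
Proof.
move=> t0 i w; have [_ _ /(_ i)[Zw _ _] /(_ i) deg] := Zcc.
have : (`|c i * c' i| `^ lambda = 0)%R.
  move/eqP: t0; rewrite psumr_eq0 => [/allP/(_ i)|*]; rewrite ?powR_ge0//.
  by rewrite mem_index_enum => /(_ isT)/eqP.
move=> /powR_eq0_eq0/eqP; rewrite normr_eq0 => /eqP/deg[c0 c'0].
by have [|] := Zw w; rewrite ?c0 ?c'0.
Qed.

Let measurable_scaled i (D : R) : measurable_fun setT (fun w => Z i w * D)%R.
Proof. exact: measurable_funM. Qed.

(** Dividing the variables by [D = t^(1/(2 lambda))] divides each [c_i * c'_i] by
    [D^2], hence the sum of their powers [lambda] by [D^(2 lambda) = t]. *)
Lemma two_value_expectations_rescaled : (0 < t)%R ->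
  two_value_expectations n lambda f
    'E_P[fun w => f ((\sum_(i < n) Z i w) / (t `^ (2 * lambda)^-1))%R].
Proof.
move=> t0; set D := (t `^ (2 * lambda)^-1)%R.
have D0 : (0 < D)%R by exact: powR_gt0.
have [Z_indep Z_mean Z_two _] := Zcc.
pose Z' i : {RV P >-> R} := HB.pack (fun w => Z i w * D^-1)%R
  (isMeasurableFun.Build _ _ _ _ _ (measurable_scaled i D^-1)).
have mscale A : measurable A -> measurable ((fun x : R => x * D^-1)%R @^-1` A).
  by move=> mA; rewrite -[X in measurable X]setTI; exact: measurable_funM.
have set1E (x : R) : (fun y : R => y * D^-1)%R @^-1` [set (x * D^-1)%R] = [set x].
  apply/seteqP; split => y /=; last by move=> ->.
  by move/mulIf; apply; rewrite invr_eq0 gt_eqF.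
exists d, T, P, Z', (fun i => c i * D^-1)%R, (fun i => c' i * D^-1)%R; split.
- move=> J A mA.
  exact: (Z_indep J (fun i => (fun x => x * D^-1)%R @^-1` A i)
    (fun i => mscale _ (mA i))).
- move=> i; have [Z_int] := Z_mean i; rewrite unlock => EZ; split.
    exact: (integrableZr measurableT D^-1 Z_int).
  by rewrite unlock -[RHS](mul0e D^-1%:E) -EZ -integralZr.
- move=> i; have [Zw Zc Zc'] := Z_two i; split.
  + by move=> w /=; have [->|->] := Zw w; [left|right].
  + by rewrite -(set1E (c i)) in Zc.
  + by rewrite -(set1E (c' i)) in Zc'.
- under eq_bigr => i _.
    rewrite mulrACA normrM powRM// [X in (_ * X)%R](_ : _ = t^-1)%R; last first.
      rewrite gtr0_norm ?mulr_gt0 ?invr_gt0// /D -powRN -powRD; last first.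
        by rewrite (gt_eqF t0) implybT.
      rewrite -powRrM -(powR_inv1 (ltW t0)); congr (_ `^ _)%R; field.
      by rewrite gt_eqF.
    over.
  by rewrite -big_distrl/= mulfV// gt_eqF.
- congr expectation; apply/funext => w; congr f.
  by rewrite big_distrl.
Qed.

End rescaling.

Theorem theorem2p5 (d : measure_display) (T : measurableType d) (R : realType)
    (P : probability T R) (n : nat) (X U : 'I_n -> {RV P >-> R})
    (X_indep : independent_RVs X)
    (X_mean : forall i, zero_mean (X i))
    (U_unif : forall i, uniform01 (U i))
    (U_indep : independent_RVs U)
    (XU_indep : independent_families X U)
    (lambda : R) (lambda_gt0 : (0 < lambda)%R)
    (f : R -> R) (f_meas : measurable_fun [set: R] f)
    (f_ge0 : forall x, (0 <= f x)%R) :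
  'E_P[fun w => f (self_normalized_sum X U lambda w)] <=
  Order.max (f 0%R)%:E (ereal_sup (two_value_expectations n lambda f)).
Proof.
pose r := ((2 * lambda)^-1)%R.
pose psi (p : R * \bar R) : \bar R := (f (p.1 * (fine (p.2 `^ r)) `^ (-1))%R)%:E.
have psiE x y : psi (x, y) = (f (x / fine (y `^ r))%R)%:E.
  by rewrite /psi powR_inv1// fine_ge0// poweR_ge0.
have mpsi : measurable_fun setT psi.
  apply/measurable_EFinP; apply: (measurableT_comp f_meas).
  apply: measurable_funM; first exact: measurable_fst.
  apply: (measurableT_comp (measurable_powR _)).
  apply: (measurableT_comp (fine_measurable measurableT)).
  by apply: (measurableT_comp (measurable_poweR _)); exact: measurable_snd.
have psi0 p : 0 <= psi p by rewrite lee_fin.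
apply: (@le_trans _ _ (\int[P]_w psi (tail_sum X 0 w, tail_scale X U lambda 0 w))).
  rewrite unlock le_eqVlt; apply/orP; left; apply/eqP.
  by apply: eq_integral => w _; rewrite psiE.
apply: (tail_comparison X_indep U_indep XU_indep X_mean U_unif (m := n)) => //.
move=> d' T' P' Z c c' Zcc.
have : (0 <= \sum_(i < n) `|c i * c' i| `^ lambda)%R.
  by apply: sumr_ge0 => i _; exact: powR_ge0.
rewrite le_eqVlt => /orP[/eqP/esym t0|t0].
  rewrite (eq_integral (cst (f 0%R)%:E)); last first.
    move=> w _; rewrite psiE big1 ?mul0r// => i _.
    exact: (two_point_family_eq0 Zcc t0).
  rewrite (@integral_cst _ _ _ P' setT)// [X in _ * X](_ : _ = 1).
    by rewrite mule1 le_max lexx.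
  exact: probability_setT.
rewrite le_max; apply/orP; right; apply: ereal_sup_ubound.
have := two_value_expectations_rescaled f lambda_gt0 Zcc t0.
rewrite unlock; congr (two_value_expectations _ _ _ _).
by apply: eq_integral => w _; rewrite psiE.
Qed.
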